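(* Let $(W,S)$ be of type $D_{n+2}$ with $S=\{0^+,0^-,1,\dots,n\}$, and write $p_{ij}=p_{e,w_{ij}}$ for $i,j\in S$. In all sums below exponents decrease by $4$. For $n$ even, $$p_{0^+0^+}=p_{0^-0^-}=v^{\ell(w_0)-1}+v^{\ell(w_0)-5}+\cdots+v^{\ell(w_0)-2n-1},$$ $$p_{0^+0^-}=p_{0^-0^+}=v^{\ell(w_0)-3}+v^{\ell(w_0)-7}+\cdots+v^{\ell(w_0)-2n+1}.$$ For $n$ odd, $$p_{0^+0^+}=p_{0^-0^-}=v^{\ell(w_0)-3}+v^{\ell(w_0)-7}+\cdots+v^{\ell(w_0)-2n-1},$$ $$p_{0^+0^-}=p_{0^-0^+}=v^{\ell(w_0)-1}+v^{\ell(w_0)-5}+\cdots+v^{\ell(w_0)-2n+1}.$$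
   Context: Type $D_{n+2}$ (with $n\geq2$): the Coxeter diagram is simply laced with nodes $0^+,0^-,1,\dots,n$; edges $m-(m+1)$ for $1\leq m<n$, and $0^+-1$, $0^--1$. $w_0$ is the longest element, $\ell$ the length function, $\ell(w_0)=(n+1)(n+2)$, $e$ the identity. Let $\widehat{\cdot}$ be the identity map on $S$ if $n$ is even, and the map swapping $0^+\leftrightarrow0^-$ and fixing the other elements if $n$ is odd. For $i,j\in S$ let $s_{ij}=i\cdots j$ be the product of simple reflections along the unique shortest path from $i$ to $j$ in the diagram, and $w_{ij}=s_{i\,\widehat\jmath}\cdot w_0$. ($w_{ij}$ is the unique element of the penultimate two-sided Kazhdan–Lusztig cell with unique left ascent $i$ and unique right ascent $j$.) Kazhdan–Lusztig polynomials: the Hecke algebra over $\mathbb Z[v,v^{-1}]$ is generated by $H_s$, $s\in S$, with the braid relations and $(H_s+v)(H_s-v^{-1})=0$; $H_w$ is the standard basis; the bar involution satisfies $\overline v=v^{-1}$, $\overline{H_s}=H_s^{-1}$. $\underline H_w$ is the unique bar-invariant element of the form $H_w+\sum_{y<w}p_{y,w}H_y$ with $p_{y,w}\in v\mathbb Z[v]$. *)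

(* Defs.v *)
From HB Require Import structures.
From mathcomp Require Import all_boot all_order all_fingroup all_algebra.
From mathcomp Require Import boolp.

Set Implicit Arguments.
Unset Strict Implicit.
Unset Printing Implicit Defensive.

Import GRing.Theory.
Local Open Scope ring_scope.

(* The ring Z[v, v^-1] is built as the subring of Z(v) of the fractions p / v^k. *)

Local Notation "p %:F" := (@FracField.tofrac {poly int} p).

Definition isLaurent : {pred {fraction {poly int}}} :=
  fun f => `[< exists (p : {poly int}) (k : nat), f = p%:F / 'X%:F ^+ k >].

Lemma polyX_frac_neq0 k : 'X%:F ^+ k != 0 :> {fraction {poly int}}.
Proof. by rewrite expf_neq0 // tofrac_eq0 polyX_eq0. Qed.

Lemma isLaurent_subring : subring_closed isLaurent.
Proof.
split=> [|f g /asboolP[p [k ->]] /asboolP[q [l ->]]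
         |f g /asboolP[p [k ->]] /asboolP[q [l ->]]]; apply/asboolP.
- by exists 1, 0%N; rewrite expr0 tofrac1 divr1.
- exists (p * 'X^l - q * 'X^k), (k + l)%N.
  rewrite -mulNr addf_div ?polyX_frac_neq0 // exprD.
  by rewrite tofracB !tofracM !tofracXn mulNr.
- by exists (p * q), (k + l)%N; rewrite mulf_div exprD tofracM.
Qed.

HB.instance Definition _ :=
  GRing.isSubringClosed.Build {fraction {poly int}} isLaurent isLaurent_subring.

Record laurent := Laurent {
  laurent_val : {fraction {poly int}};
  laurent_valP : laurent_val \in isLaurent
}.

HB.instance Definition _ := [isSub for laurent_val].
HB.instance Definition _ := [Choice of laurent by <:].
HB.instance Definition _ := [SubChoice_isSubComNzRing of laurent by <:].

Lemma v_subproof : 'X%:F \in isLaurent.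
Proof. by apply/asboolP; exists 'X, 0%N; rewrite expr0 divr1. Qed.

Lemma vV_subproof : ('X%:F)^-1 \in isLaurent.
Proof. by apply/asboolP; exists 1, 1%N; rewrite expr1 tofrac1 mul1r. Qed.

Definition v : laurent := Laurent v_subproof.
Definition vV : laurent := Laurent vV_subproof.

Lemma v_vV : v * vV = 1.
Proof. by apply: val_inj; rewrite /= divff // tofrac_eq0 polyX_eq0. Qed.

Definition in_vZv (f : laurent) : Prop :=
  exists q : {poly int}, f = v * (map_poly (fun z : int => z%:~R) q).[v].

(* v^(l-a) + v^(l-a-4) + ... + v^(l-b), for a <= b <= l with b = a mod 4 *)
Definition vsum (l a b : nat) : laurent :=
  \sum_(a <= k < b.+1 | k == a %[mod 4]) v ^+ (l - k).

Section Shortest.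
Variables (I : finType) (P : pred (seq I)) (exP : exists u, P u).

Lemma exists_size : exists k, [exists t : k.-tuple I, P t].
Proof.
by have [u Pu] := exP; exists (size u); apply/existsP; exists (in_tuple u).
Qed.

Lemma exists_min_size : exists t : (ex_minn exists_size).-tuple I, P t.
Proof. by case: ex_minnP => k /existsP. Qed.

Definition shortest : seq I := xchoose exists_min_size.

Lemma shortestP : P shortest /\ forall u, P u -> (size shortest <= size u)%N.
Proof.
split=> [|u Pu]; first exact: (xchooseP exists_min_size).
rewrite size_tuple; case: ex_minnP => k _; apply.
by apply/existsP; exists (in_tuple u).
Qed.
End Shortest.

(* The finite Coxeter group W with Coxeter matrix m: the group presented by
   generators indexed by I and the relations (s_i s_j)^(m i j) = 1. *)
Record coxeterSystem (I : finType) (m : I -> I -> nat) (W : finGroupType) := {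
  gen :> I -> W;
  gen_rel : forall i j, ((gen i * gen j) ^+ m i j = 1)%g;
  gen_surj : forall w, exists u, w == (\prod_(i <- u) gen i)%g;
  gen_universal : forall (G : groupType) (f : I -> G),
    (forall i j, ((f i * f j) ^+ m i j = 1)%g) ->
    exists phi : {multiplicative W -> G}, forall i, phi (gen i) = f i
}.

Section Coxeter.
Variables (I : finType) (m : I -> I -> nat) (W : finGroupType).
Variable S : coxeterSystem m W.

Definition reduced_word (w : W) : seq I := shortest (gen_surj S w).

Definition len (w : W) : nat := size (reduced_word w).

Definition longest : W := [arg max_(w > 1%g) len w].

Definition is_reflection (t : W) : bool :=
  [exists i, exists x : W, t == (S i ^ x)%g].

Definition bruhat_le : rel W :=
  connect (fun y w => (len y < len w)%N
                      && [exists t, is_reflection t && (w == y * t)%g]).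

Definition bruhat_lt : rel W := fun y w => (y != w) && bruhat_le y w.

Definition alternating (i j : I) : seq I :=
  mkseq (fun k => if odd k then j else i) (m i j).

Definition hecke_relations (B : algType laurent) (h : I -> B) : Prop :=
  (forall i j, \prod_(k <- alternating i j) h k =
               \prod_(k <- alternating j i) h k) /\
  (forall i, (h i + v%:A) * (h i - vV%:A) = 0).

(* HH is the algebra presented by the generators H and the Hecke relations *)
Definition is_hecke_algebra (HH : algType laurent) (H : I -> HH) : Prop :=
  hecke_relations H /\
  forall (B : algType laurent) (h : I -> B), hecke_relations h ->
    (exists phi : {lrmorphism HH -> B}, forall i, phi (H i) = h i) /\
    (forall phi psi : {lrmorphism HH -> B},
       (forall i, phi (H i) = h i) -> (forall i, psi (H i) = h i) ->
       phi =1 psi).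

Section Hecke.
Variables (HH : algType laurent) (H : I -> HH).

(* independent of the chosen reduced word, by Matsumoto's theorem *)
Definition std_basis (w : W) : HH := \prod_(i <- reduced_word w) H i.

Definition is_bar_involution (bar : {rmorphism HH -> HH}) : Prop :=
  bar v%:A = vV%:A /\
  forall i, bar (H i) * H i = 1 /\ H i * bar (H i) = 1.

Definition is_KL_family (bar : HH -> HH) (p : W -> W -> laurent) : Prop :=
  forall w : W,
    let C := std_basis w + \sum_(y | bruhat_lt y w) p y w *: std_basis y in
    bar C = C /\ forall y, bruhat_lt y w -> in_vZv (p y w).
End Hecke.
End Coxeter.

(* The diagram of type D_(n+2): inl true and inl false are the nodes 0+ and
   0-, and inr i, with i < n, is the node i + 1. *)

Definition Dnode (n : nat) : finType := (bool + 'I_n)%type.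

Definition Oplus {n} : Dnode n := inl true.
Definition Ominus {n} : Dnode n := inl false.

Section TypeD.
Variable n : nat.

Definition Dadj : rel (Dnode n) := fun x y =>
  match x, y with
  | inr i, inr j => (i.+1 == j :> nat) || (j.+1 == i :> nat)
  | inl _, inr i | inr i, inl _ => i == 0 :> nat
  | inl _, inl _ => false
  end.

Definition Dmatrix (x y : Dnode n) : nat :=
  if x == y then 1%N else if Dadj x y then 3%N else 2%N.

Definition hat (x : Dnode n) : Dnode n :=
  match x with
  | inl b => inl (if odd n then ~~ b else b)
  | inr i => inr i
  end.

(* u is the list of all the nodes of a path from x to y, endpoints included *)
Definition path_between (x y : Dnode n) (u : seq (Dnode n)) : bool :=
  if u is x' :: u' then [&& x' == x, path Dadj x u' & last x u' == y]
  else false.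

Lemma Dadj_sym : symmetric Dadj.
Proof. by case=> [b|i] [c|j] //=; rewrite orbC. Qed.

Lemma Dadj_connected (hn : (0 < n)%N) (x y : Dnode n) :
  exists u, path_between x y u.
Proof.
suff conn1 z : connect Dadj z (inr (Ordinal hn)).
  have /connectP[u pu ->] : connect Dadj x y.
    apply: connect_trans (conn1 x) _.
    by rewrite (sym_connect_sym Dadj_sym).
  by exists (x :: u); rewrite /= !eqxx pu.
case: z => [b|[k kn]]; first by apply: connect1.
elim: k kn => [|k IHk] kn; first by rewrite (_ : Ordinal kn = Ordinal hn) //; exact: val_inj.
apply: connect_trans (IHk (ltnW kn)); apply: connect1.
by rewrite /= eqxx orbT.
Qed.

Section Elements.
Variables (hn : (0 < n)%N) (W : finGroupType) (S : coxeterSystem Dmatrix W).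

Definition s_ (i j : Dnode n) : W :=
  (\prod_(k <- shortest (Dadj_connected hn i j)) S k)%g.

Definition w_ (i j : Dnode n) : W := (s_ i (hat j) * longest S)%g.
End Elements.
End TypeD.

(* Main.v *)
Require Import Defs.
From mathcomp Require Import all_boot all_order all_fingroup all_algebra.
From mathcomp Require Import boolp zify ring.

Set Implicit Arguments.
Unset Strict Implicit.
Unset Printing Implicit Defensive.

Import Order.TTheory GRing.Theory Num.Theory.

(** Let T y be the standard basis, l0 the length of the longest element w0,
    and A = (v + v^-1) - (adjacency matrix) the quantum Cartan matrix of the
    diagram.  The Hecke algebra acts on functions on the nodes by the operators
    Q_i = v - e_i A_i, where e_i is the unit vector of i and A_i the row i of A:
    this is the deformed reflection representation, and by Matsumoto's theorem
    ([Matsumoto]) it gives an operator Q_y for every y in W.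

    Since C_i = H_i + v acts on the Kazhdan-Lusztig elements C_(i j) of the
    penultimate cell through the same matrices, up to multiples of C_w0, their
    coefficients must be matrix coefficients of this representation.  This
    suggests the matrices G(y) given by G(1) = 0 and
      G(s_i y) = Q_i G(y) + v^l(y) e_i e_i^T   for s_i y longer than y,
    or equivalently G(y) A = v^l(y) - Q_y ([pen_coef_cartan]), and the elements
    C_(i j) = sum_y G(y)_(i j) T (y w0) of the Hecke algebra ([Cpen]).

    They are Kazhdan-Lusztig elements for two reasons.  First, C_(i j) minus its
    image under the bar involution solves a homogeneous linear system under the
    C_i, in which the coefficient at w0 determines all the others, and that
    coefficient is 0 ([vanish_downward], [bar_Cpen]).  Second, the recursion
    shows that the entry (i, j) of G(y) is a polynomial in v whose constant term
    is 1 if y is the product sigma_i of the generators along the path from i to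
    j, and 0 otherwise ([pen_coef_const]); this uses that the diagram is a tree.  The Kazhdan-Lusztig element of an element of W is characterized by
    these two properties ([bar_invariant_eq0]), so the element of sigma_i w0 is
    C_(i j), whose coefficient at the identity is G(w0)_(i j)
    ([KL_penultimate]).  With hat j in place of j, sigma_i w0 is w_(i j).

    It remains to solve G(w0) A = v^l0 - Q_w0.  Conjugation by w0 is the diagram
    automorphism hat, so Schur's lemma makes Q_w0 a multiple of the permutation
    matrix of hat; following the end node of the long branch along a reduced
    word of w0 gives the factor - v^(n(n+1)) ([refl_act_longest_unit]).  That
    word, its length l0 = (n+1)(n+2) and the conjugation by w0 are read off from
    the signed permutations: a word is reduced when each of its letters moves
    the image of a dominant vector across a wall from the positive side
    ([game_pos], [fires_reduced]).  The linear system is then solved from the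
    end of the long branch to the fork ([solve_inl]).

    The standard basis is linearly independent because the Hecke algebra acts
    on the functions on W, freely on the indicator function of 1
    ([left_op_relations], [std_coef_std]); only simply laced diagrams occur, for
    which the braid relations have length two or three.  In type D the number of
    nodes on the long branch is written n.+1. *)

(** * Lengths, reflections and strong exchange *)

Section CoxeterGroups.
Local Open Scope group_scope.
Variables (I : finType) (adj : rel I).

Definition simply_laced (i j : I) : nat :=
  if i == j then 1%N else if adj i j then 3%N else 2%N.

Local Notation m := simply_laced.
Variables (W : finGroupType) (S : coxeterSystem m W).

Definition word_val (u : seq I) : W := \prod_(i <- u) S i.

Lemma word_val_cons i u : word_val (i :: u) = S i * word_val u.
Proof. exact: big_cons. Qed.

Lemma word_val_cat u u' : word_val (u ++ u') = word_val u * word_val u'.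
Proof. exact: big_cat. Qed.

Lemma gen_sq i : S i * S i = 1.
Proof. by have := gen_rel S i i; rewrite /m eqxx expg1. Qed.

Lemma gen_invg i : (S i)^-1 = S i.
Proof. by apply: (mulgI (S i)); rewrite gen_sq mulgV. Qed.

Lemma gen_mulK i (w : W) : S i * (S i * w) = w.
Proof. by rewrite mulgA gen_sq mul1g. Qed.

Lemma word_val_rev u : word_val (rev u) = (word_val u)^-1.
Proof.
elim: u => [|i u IHu]; first by rewrite /word_val big_nil invg1.
by rewrite rev_cons -cats1 word_val_cat IHu !word_val_cons /word_val big_nil mulg1 invMg gen_invg.
Qed.

Lemma reduced_wordK w : word_val (reduced_word S w) = w.
Proof. by have [/eqP vw _] := shortestP (gen_surj S w); rewrite {2}vw. Qed.

Lemma len_word_val u : len S (word_val u) <= size u.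
Proof.
have [_ min_u] := shortestP (gen_surj S (word_val u)).
exact: (min_u u (eqxx _)).
Qed.

Lemma len1 : len S 1 = 0%N.
Proof.
by apply/eqP; rewrite -leqn0; have := len_word_val [::]; rewrite /word_val big_nil.
Qed.

Lemma len_gen_mul i w : len S (S i * w) <= (len S w).+1.
Proof.
have := len_word_val (i :: reduced_word S w).
by rewrite word_val_cons reduced_wordK.
Qed.

Lemma lenV w : len S w^-1 = len S w.
Proof.
suff le_lenV x : len S x^-1 <= len S x.
  by apply/eqP; rewrite eqn_leq le_lenV -{1}(invgK w) le_lenV.
have := len_word_val (rev (reduced_word S x)).
by rewrite word_val_rev reduced_wordK size_rev.
Qed.

(** The generators permute the pairs (t, sign), reversing the sign when t is
    the generator itself.  These permutations satisfy the Coxeter relations, so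
    that the parity of the number of crossings of the mirror of t by a word
    depends on the value of the word only. *)
Definition cross_fun i (x : W * bool) : W * bool :=
  (x.1 ^ S i, x.2 (+) (x.1 == S i)).

Lemma cross_funK i : involutive (cross_fun i).
Proof.
case=> t e; rewrite /cross_fun /= -conjgM gen_sq conjg1; congr (_, _).
rewrite (can2_eq (conjgK _) (conjgKV _)) gen_invg conjgE mulKg.
by case: (t == _); case: e.
Qed.

Definition cross i : {perm (W * bool)} := perm (can_inj (@cross_funK i)).

Lemma cross_pair_expg i j k t e :
  ((cross i * cross j) ^+ k) (t, e) =
    (t ^ ((S i * S j) ^+ k),
     e (+) \big[addb/false]_(0 <= l < k.*2) (t == (S i * S j) ^+ l * S i)).
Proof.
set c := S i * S j.
have sc l : S i * c ^- l = c ^+ l * S i.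
  elim: l => [|l IHl]; first by rewrite expg0 invg1 mulg1 mul1g.
  have scV : S i * c^-1 = c * S i by rewrite /c invMg !gen_invg mulgA.
  by rewrite {1}expgSr invMg mulgA scV -mulgA IHl mulgA -expgS.
elim: k => [|k IHk].
  by rewrite !expg0 perm1 conjg1 big_nil addbF.
rewrite expgSr permM IHk permM !permE /cross_fun /= -!conjgM.
rewrite -expgSr doubleS !big_nat_recr //= -!addbA; congr (_, _).
have conj_eq (x y z : W) : (x ^ y == z) = (x == z ^ y^-1).
  by rewrite (can2_eq (conjgK y) (conjgKV y)).
congr (_ (+) (_ (+) (_ (+) _))); rewrite conj_eq conjgE invgK.
  by rewrite sc mulgA -expgD addnn.
rewrite invMg gen_invg -[c ^+ k * S i * _]mulgA (mulgA (S i)) -/c sc.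
by clearbody c; rewrite !mulgA -expgSr -expgD addSn addnn.
Qed.

(** Along the word (i j)^m the mirrors met are those of c^l s_i for l < 2m, and
    c^m = 1 makes each of them occur an even number of times. *)
Lemma cross_rel i j : (cross i * cross j) ^+ m i j = 1.
Proof.
apply/permP=> -[t e]; rewrite cross_pair_expg perm1 gen_rel conjg1.
congr (_, _); rewrite -addnn (@big_cat_nat _ _ _ (m i j)) ?leq_addr //=.
suff -> : \big[addb/false]_(m i j <= l < m i j + m i j) (t == (S i * S j) ^+ l * S i)
        = \big[addb/false]_(0 <= l < m i j) (t == (S i * S j) ^+ l * S i).
  by rewrite addbb addbF.
rewrite -{1}[m i j]add0n big_addn addnK; apply: eq_bigr => l _.
by rewrite expgD gen_rel mulg1.
Qed.

Lemma crossing_exists :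
  exists phi : {multiplicative W -> {perm (W * bool)}}, forall i, phi (S i) = cross i.
Proof. exact: (gen_universal S cross_rel). Qed.

Definition crossing := projT1 (cid crossing_exists).

Lemma crossing_gen i : crossing (S i) = cross i.
Proof. exact: (projT2 (cid crossing_exists)). Qed.

(** The parity of the number of crossings of the mirror of t by the words of
    value w: a cocycle, whose value at reflections tells whether t shortens w. *)
Definition eta (w t : W) : bool := (crossing w (t, false)).2.

Lemma crossing1 : crossing 1 = 1.
Proof. by apply: (mulgI (crossing 1)); rewrite -gmulfM !mulg1. Qed.

Lemma crossingE w t e : crossing w (t, e) = (t ^ w, e (+) eta w t).
Proof.
rewrite /eta -(reduced_wordK w); elim: (reduced_word S w) t e => [|i u IHu] t e.
  by rewrite /word_val big_nil crossing1 !perm1 conjg1 addbF.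
rewrite word_val_cons gmulfM crossing_gen !permM !permE /cross_fun /=.
by rewrite IHu -conjgM [in RHS]IHu /= -addbA.
Qed.

Lemma etaM x y t : eta (x * y) t = eta x t (+) eta y (t ^ x).
Proof. by rewrite {1}/eta gmulfM permM !crossingE. Qed.

Lemma eta1 t : eta 1 t = false.
Proof. by rewrite /eta crossing1 perm1. Qed.

Lemma eta_gen i t : eta (S i) t = (t == S i).
Proof. by rewrite /eta crossing_gen permE. Qed.

(** The strong exchange property: an odd number of crossings of the mirror
    of t is at least one, and t deletes the letter where a crossing occurs. *)
Lemma exchange u t : eta (word_val u) t ->
  exists u1 i u2, u = u1 ++ i :: u2 /\ t * word_val u = word_val (u1 ++ u2).
Proof.
elim: u t => [|i u IHu] t; first by rewrite /word_val big_nil eta1.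
rewrite word_val_cons etaM eta_gen; have [-> _|_ /= /IHu] := eqVneq t (S i).
  by exists [::], i, u; rewrite gen_mulK.
case=> u1 [j [u2 [-> tu]]]; exists (i :: u1), j, u2; split=> //.
by rewrite cat_cons word_val_cons -tu conjgE !mulgA mulgV mul1g.
Qed.

Lemma eta_lt w t : eta w t -> len S (t * w) < len S w.
Proof.
rewrite -{1}(reduced_wordK w) => /exchange[u1 [i [u2 [def_w]]]].
rewrite reduced_wordK => ->; apply: leq_ltn_trans (len_word_val _) _.
by rewrite [len S w]/len def_w !size_cat /= addnS.
Qed.

Let conjg_self (x : W) : x ^ x = x.
Proof. by rewrite conjgE mulKg. Qed.

(** A reflection t = x^-1 s x crosses its own mirror: the crossings by x^-1 and
    by x cancel, and s contributes one. *)
Lemma eta_refl t : is_reflection S t -> eta t t.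
Proof.
case/existsP=> i /existsP[x /eqP->].
have := eta1 (S i ^ x); rewrite -(mulVg x) etaM conjgK => e0.
by rewrite {1}conjgE !etaM conjgK eta_gen eqxx conjg_self /= addbN e0.
Qed.

Lemma refl_sq t : is_reflection S t -> t * t = 1.
Proof. by case/existsP=> i /existsP[x /eqP->]; rewrite -conjMg gen_sq conj1g. Qed.

Lemma eta_gt w t : is_reflection S t -> ~~ eta w t -> len S w < len S (t * w).
Proof.
move=> refl_t eta_w; rewrite -{1}[w]mul1g -(refl_sq refl_t) -mulgA.
by apply: eta_lt; rewrite etaM eta_refl // conjg_self (negPf eta_w).
Qed.

Lemma gen_refl i : is_reflection S (S i).
Proof. by apply/existsP; exists i; apply/existsP; exists 1; rewrite conjg1. Qed.

Definition descent i w := eta w (S i).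

Lemma descent_lt i w : descent i w = (len S (S i * w) < len S w).
Proof.
apply/idP/idP=> [/eta_lt//|]; apply: contraTT => /(eta_gt (gen_refl i)) lt_w.
by rewrite -leqNgt ltnW.
Qed.

Lemma descent_mul i w : descent i (S i * w) = ~~ descent i w.
Proof. by rewrite /descent etaM eta_gen eqxx conjg_self. Qed.

Lemma len_up i w : ~~ descent i w -> len S (S i * w) = (len S w).+1.
Proof.
move=> up_i; apply/eqP; rewrite eqn_leq len_gen_mul /=.
exact: eta_gt (gen_refl i) up_i.
Qed.

Lemma len_down i w : descent i w -> len S w = (len S (S i * w)).+1.
Proof. by move=> dn_i; rewrite -{1}(gen_mulK i w) len_up // descent_mul dn_i. Qed.

Lemma descent1 i : descent i 1 = false.
Proof. exact: eta1. Qed.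

Lemma descent_reduced i u : len S (word_val (i :: u)) = (size u).+1 ->
  descent i (word_val (i :: u)).
Proof.
by move=> lu; rewrite descent_lt lu word_val_cons gen_mulK ltnS len_word_val.
Qed.

Lemma descent_exists w : w != 1 -> exists i, descent i w.
Proof.
rewrite -(reduced_wordK w); case def_u: (reduced_word S w) => [|i u].
  by rewrite /word_val big_nil eqxx.
move=> _; exists i; apply: descent_reduced.
by rewrite -def_u reduced_wordK /len def_u.
Qed.

Lemma no_descent w : (forall i, ~~ descent i w) -> w = 1.
Proof.
move=> up_w; apply/eqP/negPn/negP => /descent_exists[i].
by rewrite (negPf (up_w i)).
Qed.

(** Induction along the left weak order. *)
Lemma weak_ind (P : W -> Prop) : P 1 ->
  (forall i w, ~~ descent i w -> P w -> P (S i * w)) -> forall w, P w.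
Proof.
move=> P1 PS w; have [k] := ubnP (len S w); elim: k w => // k IHk w le_w.
have [->//|/descent_exists[i dn_i]] := eqVneq w 1.
rewrite -(gen_mulK i w); apply: PS; first by rewrite descent_mul dn_i.
by apply: IHk; rewrite -ltnS -len_down.
Qed.

Local Notation w0 := (longest S).

Lemma len_longest w : len S w <= len S w0.
Proof. by rewrite /longest; case: arg_maxnP => // x _; apply. Qed.

Lemma eta_longest t : is_reflection S t -> eta w0 t.
Proof.
move=> refl_t; apply/negPn/negP => /(eta_gt refl_t).
by rewrite ltnNge len_longest.
Qed.

(** All reflections shorten w0, hence multiplication by w0 exchanges ascents
    and descents. *)
Lemma descent_mul_longest i y : descent i (y * w0) = ~~ descent i y.
Proof.
rewrite /descent etaM eta_longest; first by rewrite addbT.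
by apply/existsP; exists i; apply/existsP; exists y.
Qed.

Lemma longest_sq : w0 * w0 = 1.
Proof.
apply: no_descent => i; rewrite descent_mul_longest negbK.
by rewrite -[w0]mul1g descent_mul_longest descent1.
Qed.

Lemma longestV : w0^-1 = w0.
Proof. by apply: (mulgI w0); rewrite longest_sq mulgV. Qed.

Lemma longest_mulK x : x * w0 * w0 = x.
Proof. by rewrite -mulgA longest_sq mulg1. Qed.

(** If w has all descents then w w0 has none, so w w0 = 1. *)
Lemma all_descents w : (forall i, descent i w) -> w = w0.
Proof.
move=> dn_w; suff ww0 : w * w0 = 1 by rewrite -[w]longest_mulK ww0 mul1g.
by apply: no_descent => i; rewrite descent_mul_longest negbK.
Qed.

(** Prepending the letter i to w is the right multiplication by the reflection
    S i ^ w. *)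
Lemma bruhat_ge1 w : bruhat_le S 1 w.
Proof.
elim/weak_ind: w => [|i w up_i le_w]; first exact: connect0.
apply: connect_trans le_w _; apply: connect1; rewrite len_up // leqnn /=.
apply/existsP; exists (S i ^ w); rewrite {2}conjgE mulKVg eqxx andbT.
by apply/existsP; exists i; apply/existsP; exists w.
Qed.
End CoxeterGroups.

(** * Reflection operators and Matsumoto's theorem *)

Section Reflections.
Local Open Scope ring_scope.
Variables (I : finType) (adj : rel I) (K : Type) (R : comNzRingType).
Variables (a a' : R) (al : I -> (K -> R) -> R) (root : I -> K -> R).

(** An abstract reflection x |-> a x - al i x * root i, with eigenvalues a
    and - a'.  For a = a' = 1 these are the reflections of a Coxeter group, for
    a = v and a' = v^-1 those of a module over its Hecke algebra.  The three
    conditions below on the linear forms al i express the pairing of the roots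
    by a simply laced Cartan matrix. *)
Definition reflop i (x : K -> R) : K -> R := fun k => a * x k - al i x * root i k.

Lemma reflopE i x k : reflop i x k = a * x k - al i x * root i k.
Proof. by []. Qed.

Hypothesis adj_sym : symmetric adj.
Hypothesis aa' : a * a' = 1.
Hypothesis al_diag : forall i x, al i (reflop i x) = - a' * al i x.
Hypothesis al_adj : forall i j x, i != j -> adj i j ->
  al i (reflop j x) = a * al i x + al j x.
Hypothesis al_nadj : forall i j x, i != j -> ~~ adj i j ->
  al i (reflop j x) = a * al i x.

Lemma reflop_comm i j x : i != j -> ~~ adj i j ->
  reflop i (reflop j x) = reflop j (reflop i x).
Proof.
move=> ne_ij nadj_ij; apply/funext=> k.
rewrite {1}/reflop [in RHS]/reflop al_nadj // al_nadj 1?eq_sym 1?adj_sym //.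
by rewrite /reflop; ring.
Qed.

Lemma reflop_braid i j x : i != j -> adj i j ->
  reflop i (reflop j (reflop i x)) = reflop j (reflop i (reflop j x)).
Proof.
move=> ne_ij adj_ij; have ne_ji : j != i by rewrite eq_sym.
have adj_ji : adj j i by rewrite adj_sym.
have al2 p q y : p != q -> adj p q -> al p (reflop q (reflop p y)) = a * al q y.
  move=> ne_pq adj_pq; rewrite al_adj // al_diag al_adj 1?eq_sym 1?adj_sym //.
  by ring: aa'.
apply/funext=> k; rewrite !reflopE !al2 // !al_adj //.
by ring.
Qed.

Lemma reflop_inv i x : a = 1 -> a' = 1 -> reflop i (reflop i x) = x.
Proof.
move=> a1 a'1; apply/funext=> k; rewrite !reflopE al_diag a1 a'1; ring.
Qed.
End Reflections.

Section DistinctGenerators.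
Local Open Scope group_scope.
Variables (I : finType) (adj : rel I) (W : finGroupType).
Hypothesis adj_sym : symmetric adj.
Variable S : coxeterSystem (simply_laced adj) W.

(** The geometric representation modulo 3: it is a finite permutation group,
    and it separates the generators since -1 <> 1 modulo 3. *)
Let al3 i (x : I -> 'F_3) : 'F_3 :=
  (x i + x i - \sum_(l | adj i l && (l != i)) x l)%R.
Let root3 (i k : I) : 'F_3 := ((k == i)%:R)%R.
Let op3 := reflop 1%R al3 root3.

Let al3_op i j x : (al3 i (op3 j x) =
  al3 i x - al3 j x * ((i == j)%:R + (i == j)%:R - (adj i j && (j != i))%:R))%R.
Proof.
have sum_root : (\sum_(l | adj i l && (l != i)) root3 j l = (adj i j && (j != i))%:R)%R.
  rewrite /root3; case: (boolP (adj i j && (j != i))) => Pj.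
    rewrite (bigD1 j) //= eqxx big1 ?addr0 // => l /andP[_ /negPf->//].
  by rewrite big1 // => l Pl; case: eqP => // lj; rewrite lj (negPf Pj) in Pl.
have -> : al3 i (op3 j x) = (op3 j x i + op3 j x i -
    (\sum_(l | adj i l && (l != i)) x l -
     al3 j x * \sum_(l | adj i l && (l != i)) root3 j l))%R.
  rewrite /al3 mulr_sumr -sumrB; congr (_ - _)%R; apply: eq_bigr => l _.
  by rewrite /op3 /reflop mul1r.
by rewrite sum_root /op3 /reflop /root3 [al3 i x]/al3; ring.
Qed.

Let op3K i x : op3 i (op3 i x) = x.
Proof.
apply: (@reflop_inv _ _ _ 1%R 1%R) => // j y.
by rewrite -/op3 al3_op eqxx /= andbF /=; ring.
Qed.

Let perm3_fun i (x : {ffun I -> 'F_3}) : {ffun I -> 'F_3} := [ffun k => op3 i x k].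

Let perm3_funE i x : perm3_fun i x = op3 i x :> (I -> 'F_3).
Proof. by apply/funext=> k; rewrite ffunE. Qed.

Let perm3_funK i : involutive (perm3_fun i).
Proof. by move=> x; apply/ffunP=> k; rewrite ffunE perm3_funE op3K. Qed.

Let perm3 i : {perm {ffun I -> 'F_3}} := perm (can_inj (@perm3_funK i)).

Let perm3_rel i j : (perm3 i * perm3 j) ^+ simply_laced adj i j = 1.
Proof.
have al_adj p q x : p != q -> adj p q -> (al3 p (op3 q x) = 1 * al3 p x + al3 q x)%R.
  by move=> ne_pq adj_pq; rewrite al3_op (negPf ne_pq) adj_pq eq_sym ne_pq /=; ring.
have al_nadj p q x : p != q -> ~~ adj p q -> (al3 p (op3 q x) = 1 * al3 p x)%R.
  by move=> ne_pq nadj_pq; rewrite al3_op (negPf ne_pq) (negPf nadj_pq) /=; ring.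
have al_diag p x : (al3 p (op3 p x) = - 1 * al3 p x)%R.
  by rewrite al3_op eqxx /= andbF /=; ring.
have braid p q x : p != q -> adj p q -> op3 p (op3 q (op3 p x)) = op3 q (op3 p (op3 q x)).
  by move=> ne_pq adj_pq; apply: (@reflop_braid _ adj _ _ 1%R 1%R) => //; rewrite mulr1.
have comm p q x : p != q -> ~~ adj p q -> op3 p (op3 q x) = op3 q (op3 p x).
  by move=> ne_pq nadj_pq; apply: (@reflop_comm _ adj _ _ 1%R).
apply/permP=> x; apply/ffunP=> k; rewrite perm1 /simply_laced.
have [->|ne_ij] := eqVneq i j; first by rewrite expg1 permM !permE perm3_funK.
case: ifP => [adj_ij|/negbT nadj_ij].
  rewrite !expgS expg0 mulg1 !permM !permE ffunE !perm3_funE.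
  by rewrite -(braid i j) // !op3K.
rewrite !expgS expg0 mulg1 !permM !permE ffunE !perm3_funE.
by rewrite -(comm i j) // !op3K.
Qed.

(** S i changes the sign of the coordinate i of its own root, which S j leaves
    unchanged for j <> i. *)
Lemma gen_inj : injective S.
Proof.
move=> i j eqS; apply/eqP; apply: contraTT isT => ne_ij.
have [phi phiE] := gen_universal S perm3_rel.
have: perm3 i [ffun k => (k == i)%:R%R] i = perm3 j [ffun k => (k == i)%:R%R] i.
  by rewrite -!phiE eqS.
rewrite !permE !ffunE /op3 !reflopE /root3 !ffunE !eqxx (negPf ne_ij) mulr0 subr0.
suff -> : al3 i [ffun k => (k == i)%:R%R] = (1 + 1)%R by [].
rewrite /al3 ffunE eqxx big1 ?subr0 // => l /andP[_ /negPf ne_li].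
by rewrite ffunE ne_li.
Qed.

End DistinctGenerators.

Section Matsumoto.
Local Open Scope group_scope.
Variables (I : finType) (adj : rel I) (W : finGroupType).
Hypothesis adj_sym : symmetric adj.
Variable S : coxeterSystem (simply_laced adj) W.

Definition reduced (u : seq I) := len S (word_val S u) == size u.

Lemma reduced_word_reduced w : reduced (reduced_word S w).
Proof. by rewrite /reduced reduced_wordK. Qed.

Lemma reduced_cons i u :
  reduced (i :: u) = reduced u && ~~ descent S i (word_val S u).
Proof.
rewrite /reduced word_val_cons /=; have [dn_i|up_i] := boolP (descent S i _).
  rewrite andbF; apply/negbTE/eqP=> lu; have := len_word_val S u.
  by rewrite (len_down dn_i) lu => /ltnW; rewrite ltnn.
by rewrite (len_up up_i) andbT eqSS.
Qed.

Lemma reduced_behead i u : reduced (i :: u) -> reduced u.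
Proof. by rewrite reduced_cons => /andP[]. Qed.

Lemma reduced_len u : reduced u -> len S (word_val S u) = size u.
Proof. by move/eqP. Qed.

(** Here and in [two_descents_adj], two left descents of w make the longest
    element of the dihedral subgroup that they generate a prefix of w. *)
Lemma two_descents_exchange i j w : i != j -> descent S i w -> descent S j w ->
  exists2 u, reduced [:: i, j & u] & word_val S [:: i, j & u] = w.
Proof.
move=> ne_ij dn_i dn_j; pose u1 := reduced_word S (S j * w)%g.
have w_u1 : word_val S (j :: u1) = w.
  by rewrite word_val_cons reduced_wordK gen_mulK.
have : descent S i (word_val S (j :: u1)) by rewrite w_u1.
case/exchange=> -[|j' p] [k [q [/= [def_j def_u1 Siw]]]].
  case/eqP: ne_ij; apply: (gen_inj adj_sym (S := S)); apply: (mulIg (word_val S (j :: u1))).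
  by rewrite Siw word_val_cons gen_mulK def_u1.
exists (p ++ q); last first.
  by rewrite word_val_cons def_j -cat_cons -Siw gen_mulK.
rewrite /reduced word_val_cons def_j -cat_cons -Siw gen_mulK w_u1.
rewrite (len_down dn_j) /len -/u1 def_u1 /= !size_cat /= addnS.
by [].
Qed.

Lemma braid_rel i j : adj i j -> (S i * S j * S i = S j * S i * S j)%g.
Proof.
move=> adj_ij; have [->//|ne_ij] := eqVneq i j.
have := gen_rel S i j; rewrite /simply_laced (negPf ne_ij) adj_ij.
rewrite !expgS expg0 mulg1 => cube.
apply: (mulIg (S j * S i * S j)); rewrite !mulgA in cube *.
by rewrite cube -[_ * S j * S j]mulgA gen_sq mulg1 -[_ * S i * S i]mulgA gen_sq mulg1 gen_sq.
Qed.

Lemma comm_rel i j : i != j -> ~~ adj i j -> (S i * S j = S j * S i)%g.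
Proof.
move=> ne_ij /negPf nadj_ij; have := gen_rel S i j.
rewrite /simply_laced (negPf ne_ij) nadj_ij !expgS expg0 mulg1 => square.
apply: (mulIg (S i * S j)); rewrite square mulgA -[_ * S i * S i]mulgA gen_sq mulg1.
by rewrite gen_sq.
Qed.

(** Exchanging i against a word that starts with j, i can delete neither the
    first j, by the length, nor the following i, since i and j do not commute. *)
Lemma two_descents_adj i j w : i != j -> adj i j ->
  descent S i w -> descent S j w ->
  exists2 u, reduced [:: i, j, i & u] & word_val S [:: i, j, i & u] = w.
Proof.
move=> ne_ij adj_ij dn_i dn_j; have ne_ji : j != i by rewrite eq_sym.
have [u red_u w_u] := two_descents_exchange ne_ji dn_j dn_i.
have : descent S i (word_val S [:: j, i & u]) by rewrite w_u.
case/exchange=> -[|j' [|i' p]] [k [q [/= def_u Siw]]].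
- case: def_u Siw => _ <- /= Siw.
  have w_u' : word_val S u = w by rewrite -[RHS](gen_mulK S i) -w_u Siw word_val_cons gen_mulK.
  have := len_word_val S u; rewrite w_u' -w_u (reduced_len red_u).
  by move/ltnW; rewrite ltnn.
- case: def_u Siw => <- _ <- /= Siw; case/eqP: ne_ij; apply: (gen_inj adj_sym (S := S)).
  have comm_ij : S i * S j = S j * S i.
    apply: (mulIg (word_val S u)); rewrite -!mulgA -!word_val_cons.
    by rewrite word_val_cons -Siw gen_mulK.
  have := braid_rel adj_ij.
  by rewrite comm_ij -mulgA gen_sq mulg1 -comm_ij -mulgA gen_sq mulg1 => ->.
case: def_u Siw => <- <- def_u /= Siw.
have w_e : word_val S [:: i, j, i & p ++ q] = w by rewrite word_val_cons -Siw gen_mulK w_u.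
exists (p ++ q) => //; rewrite /reduced w_e -w_u (reduced_len red_u) def_u /=.
by rewrite !size_cat /= addnS.
Qed.

(** By induction on the length: when the first letters i <> j differ, both are
    descents, so a third reduced word starts with the longest alternating word
    in i and j, whose first letter can be changed by one braid relation.  The
    words act on an arbitrary type, so as to apply to the Hecke algebra, to its
    modules, and to integral vectors alike. *)
Lemma Matsumoto (X : Type) (h : I -> X -> X) :
    (forall i j x, i != j -> ~~ adj i j -> h i (h j x) = h j (h i x)) ->
    (forall i j x, i != j -> adj i j -> h i (h j (h i x)) = h j (h i (h j x))) ->
  forall u u' x, reduced u -> reduced u' -> word_val S u = word_val S u' ->
  foldr h x u = foldr h x u'.
Proof.
move=> h_comm h_braid u u' x.
move: {-2}(size u) (erefl (size u)) => k.
elim: k u u' => [|k IHk] u u' size_u red_u red_u' eq_uu'; last first.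
  have: size u' = k.+1 by rewrite -(reduced_len red_u') -eq_uu' reduced_len.
  case: u u' => // i u [|j u'] // in size_u red_u red_u' eq_uu' *; case: size_u => size_u [size_u'] /=.
  have step l v v' : size v = k -> reduced (l :: v) -> reduced (l :: v') ->
      word_val S (l :: v) = word_val S (l :: v') -> h l (foldr h x v) = h l (foldr h x v').
    move=> size_v; rewrite !reduced_cons !word_val_cons => /andP[? _] /andP[? _] /mulgI eq_v.
    by rewrite (IHk v v').
  have [eq_ij|ne_ij] := eqVneq i j; first by subst j; apply: step.
  have dn_i : descent S i (word_val S (i :: u)).
    exact/descent_reduced/reduced_len.
  have dn_j : descent S j (word_val S (i :: u)).
    rewrite eq_uu'; exact/descent_reduced/reduced_len.
  have [adj_ij|nadj_ij] := boolP (adj i j).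
    have [v red_v v_u] := two_descents_adj ne_ij adj_ij dn_i dn_j.
    have v_u' : word_val S [:: j, i, j & v] = word_val S (i :: u).
      by rewrite -v_u !word_val_cons !mulgA (braid_rel adj_ij).
    rewrite (step i u [:: j, i & v]) //.
    have red_v' : reduced [:: j, i, j & v].
      by rewrite /reduced v_u' -v_u (reduced_len red_v).
    by rewrite (step j u' [:: i, j & v]) ?v_u' //= h_braid.
  have [v red_v v_u] := two_descents_exchange ne_ij dn_i dn_j.
  have v_u' : word_val S [:: j, i & v] = word_val S (i :: u).
    by rewrite -v_u !word_val_cons !mulgA (comm_rel ne_ij).
  rewrite (step i u (j :: v)) //.
  have red_v' : reduced [:: j, i & v].
    by rewrite /reduced v_u' -v_u (reduced_len red_v).
  by rewrite (step j u' (i :: v)) ?v_u' //= h_comm.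
move: eq_uu' red_u'; rewrite (size0nil (esym size_u)) => eq_uu'.
by rewrite /reduced -eq_uu' /word_val big_nil len1 eq_sym => /nilP->.
Qed.


Definition word_act (X : Type) (h : I -> X -> X) (w : W) (x : X) : X :=
  foldr h x (reduced_word S w).

Section WordAct.
Variables (X : Type) (h : I -> X -> X).
Hypothesis h_comm : forall i j x, i != j -> ~~ adj i j -> h i (h j x) = h j (h i x).
Hypothesis h_braid : forall i j x, i != j -> adj i j ->
  h i (h j (h i x)) = h j (h i (h j x)).

Lemma word_act_reduced u x : reduced u -> word_act h (word_val S u) x = foldr h x u.
Proof.
move=> red_u; apply: Matsumoto => //; first exact: reduced_word_reduced.
exact: reduced_wordK.
Qed.

Lemma word_act1 x : word_act h 1 x = x.
Proof.
rewrite -[1](_ : word_val S [::] = 1) ?word_act_reduced //; last exact: big_nil.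
by rewrite /reduced /word_val big_nil len1.
Qed.

Lemma word_act_up i w x : ~~ descent S i w ->
  word_act h (S i * w) x = h i (word_act h w x).
Proof.
move=> up_i; rewrite -[w in LHS](reduced_wordK S) -word_val_cons word_act_reduced //.
by rewrite reduced_cons reduced_word_reduced reduced_wordK.
Qed.

Lemma word_act_mul w w' x : len S (w * w') = len S w + len S w' ->
  word_act h (w * w') x = word_act h w (word_act h w' x).
Proof.
move=> len_mul; rewrite -[w in LHS](reduced_wordK S) -[w' in LHS](reduced_wordK S).
rewrite -word_val_cat word_act_reduced ?foldr_cat //.
by rewrite /reduced word_val_cat !reduced_wordK len_mul size_cat.
Qed.
End WordAct.
End Matsumoto.

Local Open Scope ring_scope.

(** * The regular representation of the Hecke algebra *)

Section HeckeRelations.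
Variables (I : finType) (adj : rel I) (B : algType laurent) (h : I -> B).
Hypothesis adj_sym : symmetric adj.

Lemma hecke_relationsP :
  hecke_relations (simply_laced adj) h <->
  [/\ forall i j, i != j -> ~~ adj i j -> h i * h j = h j * h i,
      forall i j, i != j -> adj i j -> h i * h j * h i = h j * h i * h j &
      forall i, h i * h i = 1 + (vV - v) *: h i].
Proof.
have quadE (x : B) : (x + v%:A) * (x - vV%:A) = x * x - (1 + (vV - v) *: x).
  rewrite mulrBr !mulrDl -!scalerAr -!scalerAl !mul1r !mulr1 scalerA.
  rewrite [vV * v]mulrC v_vV scale1r scalerBl.
  rewrite -addrA; congr (_ + _); rewrite !opprD opprK addrC [RHS]addrA.
  by congr (_ + _); rewrite addrC.
split=> [[braid quad]|[comm braid quad]]; split.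
- move=> i j ne_ij /negPf nadj_ij; have := braid i j.
  rewrite /alternating /simply_laced [j == i]eq_sym (negPf ne_ij) [adj j i]adj_sym nadj_ij.
  by rewrite /mkseq /= !big_cons !big_nil !mulr1.
- move=> i j ne_ij adj_ij; have := braid i j.
  rewrite /alternating /simply_laced [j == i]eq_sym (negPf ne_ij) [adj j i]adj_sym adj_ij.
  by rewrite /mkseq /= !big_cons !big_nil !mulr1 !mulrA.
- by move=> i; apply/eqP; rewrite -subr_eq0 -quadE quad.
- move=> i j; rewrite /alternating /simply_laced [j == i]eq_sym [adj j i]adj_sym.
  have [->//|ne_ij] := eqVneq i j.
  case: ifP => [adj_ij|/negbT nadj_ij].
    by rewrite /mkseq /= !big_cons !big_nil !mulr1 !mulrA braid.
  by rewrite /mkseq /= !big_cons !big_nil !mulr1 comm.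
by move=> i; rewrite quadE quad subrr.
Qed.
End HeckeRelations.

Section RegularRepresentation.
Variables (I : finType) (adj : rel I) (W : finGroupType).
Hypothesis adj_sym : symmetric adj.
Variable S : coxeterSystem (simply_laced adj) W.

Notation L := laurent.
Implicit Types f g : W -> L.

Definition left_op i f : W -> L :=
  fun w => f (S i * w)%g + (descent S i w)%:R * (vV - v) * f w.
Definition right_op j f : W -> L :=
  fun w => f (w * S j)%g + (descent S j w^-1)%:R * (vV - v) * f w.
Definition delta w : W -> L := fun x => (x == w)%:R.

(** By the cocycle relation, j is a right descent of s_i w but not of w, or
    conversely, exactly when s_i w = w s_j; in that case the two extra terms
    coincide. *)
Lemma left_right_op i j f : left_op i (right_op j f) = right_op j (left_op i f).
Proof.
apply/funext=> w; rewrite /left_op /right_op -!mulgA.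
rewrite !invMg !gen_invg.
have dnR : descent S j (w^-1 * S i) = descent S j w^-1 (+) (S i * w == w * S j)%g.
  rewrite /descent etaM eta_gen conjgE invgK; congr (_ (+) _).
  by rewrite mulgA -(inj_eq (mulIg w)) mulgKV eq_sym.
have dnL : descent S i (w * S j) = descent S i w (+) (S i * w == w * S j)%g.
  rewrite /descent etaM eta_gen conjgE; congr (_ (+) _).
  by rewrite -(inj_eq (mulgI w)) mulKVg.
rewrite dnL dnR; case: eqP => [eq_ij|_]; last by rewrite !addbF; ring.
suff dn_eq : descent S i w = descent S j w^-1.
  by rewrite eq_ij dn_eq; case: (descent S j _); rewrite /=; ring.
by rewrite !descent_lt lenV eq_ij -[(w * _)%g]invgK invMg gen_invg lenV.
Qed.

Lemma left_op_delta i w : ~~ descent S i w -> left_op i (delta w) = delta (S i * w)%g.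
Proof.
move=> up_i; apply/funext=> x; rewrite /left_op /delta.
have -> : (S i * x == w)%g = (x == S i * w)%g.
  by rewrite -(inj_eq (mulgI (S i))) gen_mulK.
have [->|_] := eqVneq x w; last by rewrite mulr0 addr0.
by rewrite (negPf up_i) !mul0r addr0.
Qed.

Lemma right_op_delta j w : ~~ descent S j w^-1 ->
  right_op j (delta w) = delta (w * S j)%g.
Proof.
move=> up_j; apply/funext=> x; rewrite /right_op /delta.
have -> : (x * S j == w)%g = (x == w * S j)%g.
  by rewrite -(inj_eq (mulIg (S j))) -mulgA gen_sq mulg1.
have [->|_] := eqVneq x w; last by rewrite mulr0 addr0.
by rewrite (negPf up_j) !mul0r addr0.
Qed.

(** Left operators commute with the right ones, which generate all delta w
    from delta 1: identities between left operators can be checked there. *)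
Lemma eq_left_delta (P Q : (W -> L) -> W -> L) :
    (forall j f, P (right_op j f) = right_op j (P f)) ->
    (forall j f, Q (right_op j f) = right_op j (Q f)) ->
    P (delta 1%g) = Q (delta 1%g) -> forall w, P (delta w) = Q (delta w).
Proof.
move=> PR QR PQ1 w; rewrite -(invgK w); elim/(weak_ind (S := S)): w^-1%g.
  by rewrite invg1.
move=> j y up_j IHy; rewrite invMg gen_invg -right_op_delta ?invgK //.
by rewrite PR IHy QR.
Qed.

Lemma up_gen i j : i != j -> ~~ descent S i (S j).
Proof. by rewrite /descent eta_gen (inj_eq (gen_inj adj_sym (S := S))). Qed.

(** Otherwise s_i s_j s_i would be s_j s_i s_j = s_i. *)
Lemma up_gen2 i j : i != j -> adj i j -> ~~ descent S i (S j * S i)%g.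
Proof.
move=> ne_ij adj_ij; rewrite /descent etaM !eta_gen (inj_eq (gen_inj adj_sym (S := S))).
rewrite (negPf ne_ij) /= conjgE gen_invg; apply/eqP=> eq_i.
have /eqP := braid_rel S adj_ij; rewrite -[X in _ == X]mulgA eq_i.
rewrite -[X in _ == X]mul1g (inj_eq (mulIg _)) => /eqP s_ij.
case/eqP: ne_ij; apply: (gen_inj adj_sym (S := S)).
by rewrite -[RHS]mul1g -s_ij -mulgA gen_sq mulg1.
Qed.

Lemma left_op_comm i j w : i != j -> ~~ adj i j ->
  left_op i (left_op j (delta w)) = left_op j (left_op i (delta w)).
Proof.
move=> ne_ij nadj_ij.
apply: (@eq_left_delta (fun f => left_op i (left_op j f)) (fun f => left_op j (left_op i f))).
- by move=> k f; rewrite !left_right_op.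
- by move=> k f; rewrite !left_right_op.
rewrite !left_op_delta ?mulg1 ?descent1 ?up_gen // 1?eq_sym //.
by rewrite (comm_rel _ ne_ij).
Qed.

Lemma left_op_braid i j w : i != j -> adj i j ->
  left_op i (left_op j (left_op i (delta w))) = left_op j (left_op i (left_op j (delta w))).
Proof.
move=> ne_ij adj_ij; have ne_ji : j != i by rewrite eq_sym.
have adj_ji : adj j i by rewrite adj_sym.
apply: (@eq_left_delta (fun f => left_op i (left_op j (left_op i f)))
                       (fun f => left_op j (left_op i (left_op j f)))).
- by move=> k f; rewrite !left_right_op.
- by move=> k f; rewrite !left_right_op.
rewrite !left_op_delta ?mulg1 ?descent1 ?up_gen ?up_gen2 //.
by rewrite !mulgA (braid_rel S adj_ij).
Qed.

Lemma left_op_quad i f :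
  left_op i (left_op i f) = fun w => f w + (vV - v) * left_op i f w.
Proof.
apply/funext=> w; rewrite /left_op gen_mulK descent_mul.
by case: (descent S i w) => /=; ring.
Qed.

Definition op_linear (P : (W -> L) -> W -> L) :=
  forall f w, P f w = \sum_z f z * P (delta z) w.

Lemma left_op_linear i : op_linear (left_op i).
Proof.
have sum_delta f w : f w = \sum_z f z * delta z w.
  rewrite (bigD1 w) //= /delta eqxx mulr1 big1 ?addr0 // => z /negPf.
  by rewrite eq_sym => ->; rewrite mulr0.
move=> f w; rewrite {1}/left_op (sum_delta f (S i * w)%g) (sum_delta f w).
rewrite mulr_sumr -big_split /=; apply: eq_bigr => z _.
by rewrite /left_op; ring.
Qed.

Let card_W : #|W|.-1.+1 = #|W|.
Proof. by apply: prednK; apply/card_gt0P; exists 1%g. Qed.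
Let dec (a : 'I_(#|W|.-1.+1)) : W := enum_val (cast_ord card_W a).
Let enc (w : W) : 'I_(#|W|.-1.+1) := cast_ord (esym card_W) (enum_rank w).
Let encK : cancel enc dec.
Proof. by move=> w; rewrite /enc /dec cast_ordKV enum_rankK. Qed.
Let decK : cancel dec enc.
Proof. by move=> w; rewrite /enc /dec enum_valK cast_ordK. Qed.

(** Operators are turned into matrices acting on columns, for the matrices form
    an algebra to which the universal property of the Hecke algebra applies. *)
Definition op_mx (P : (W -> L) -> W -> L) : 'M[L]_(#|W|.-1.+1) :=
  \matrix_(a, b) P (delta (dec b)) (dec a).

Lemma op_mxM P Q : op_linear P -> op_mx P *m op_mx Q = op_mx (P \o Q).
Proof.
move=> linP; apply/matrixP=> a b; rewrite !mxE /= linP.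
rewrite [RHS](reindex dec) /=; last by exists enc => ? _; [apply: decK|apply: encK].
by apply: eq_bigr => c _; rewrite !mxE mulrC.
Qed.

Lemma op_linear_comp P Q : op_linear P -> op_linear Q -> op_linear (P \o Q).
Proof.
move=> linP linQ f w; rewrite /= linP.
under [LHS]eq_bigr => z _ do rewrite linQ mulr_suml.
rewrite exchange_big /=; apply: eq_bigr => y _; rewrite [P (Q _) w]linP mulr_sumr.
by apply: eq_bigr => z _; rewrite mulrA.
Qed.

Lemma left_op_relations : hecke_relations (simply_laced adj) (fun i => op_mx (left_op i)).
Proof.
apply/hecke_relationsP => //; have lin := left_op_linear.
split=> [i j ne_ij nadj_ij|i j ne_ij adj_ij|i].
- by rewrite -!mulmxE !op_mxM //; apply/matrixP=> a b; rewrite !mxE /= left_op_comm.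
- rewrite -!mulmxE !op_mxM //; try exact: op_linear_comp.
  by apply/matrixP=> a b; rewrite !mxE /= left_op_braid.
rewrite -mulmxE op_mxM //; apply/matrixP=> a b; rewrite !mxE /= left_op_quad.
by rewrite /delta (inj_eq (can_inj decK)).
Qed.

Variables (HH : algType laurent) (H : I -> HH).
Hypothesis hHH : is_hecke_algebra (simply_laced adj) H.

(** The orbit map of the regular representation at delta 1: it gives
    coordinates in the standard basis. *)
Lemma std_coef_exists : exists std_coef : HH -> W -> L,
  [/\ forall i h, std_coef (H i * h) = left_op i (std_coef h),
      std_coef 1 = delta 1%g,
      forall h h' w, std_coef (h + h') w = std_coef h w + std_coef h' w &
      forall c h w, std_coef (c *: h) w = c * std_coef h w].
Proof.
have [_ /(_ _ _ left_op_relations)[[phi phiH] _]] := hHH.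
exists (fun h w => phi h (enc w) (enc 1%g)); split.
- move=> i h; apply/funext=> w; rewrite rmorphM /= phiH -mulmxE mxE (left_op_linear i).
  rewrite [RHS](reindex dec) /=; last by exists enc => ? _; [apply: decK|apply: encK].
  by apply: eq_bigr => c _; rewrite mxE decK encK mulrC.
- apply/funext=> w; rewrite rmorph1 mxE /delta.
  by rewrite (inj_eq (can_inj encK)).
- by move=> h h' w; rewrite rmorphD mxE.
by move=> c h w; rewrite linearZ mxE.
Qed.

Definition std_coef := projT1 (cid std_coef_exists).
Lemma std_coefH i h : std_coef (H i * h) = left_op i (std_coef h).
Proof. by rewrite /std_coef; case: cid => c []. Qed.
Lemma std_coef1 : std_coef 1 = delta 1%g.
Proof. by rewrite /std_coef; case: cid => c []. Qed.
Lemma std_coefD h h' w : std_coef (h + h') w = std_coef h w + std_coef h' w.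
Proof. by rewrite /std_coef; case: cid => c []. Qed.
Lemma std_coefZ c h w : std_coef (c *: h) w = c * std_coef h w.
Proof. by rewrite /std_coef; case: cid => d []. Qed.
Lemma std_coefB h h' w : std_coef (h - h') w = std_coef h w - std_coef h' w.
Proof. by rewrite std_coefD -scaleN1r std_coefZ mulN1r. Qed.
Lemma std_coef_sum (J : finType) (P : pred J) (F : J -> HH) w :
  std_coef (\sum_(y | P y) F y) w = \sum_(y | P y) std_coef (F y) w.
Proof.
elim/big_rec2: _ => [|y a b _ <-]; last exact: std_coefD.
by rewrite -[0](scale0r 0) std_coefZ mul0r.
Qed.
End RegularRepresentation.

(** * Laurent polynomials with integral constant terms *)

Section LaurentPolynomials.

Definition laurent_poly (q : {poly int}) : laurent := (map_poly intr q).[v].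

Lemma laurent_polyD q r : laurent_poly (q + r) = laurent_poly q + laurent_poly r.
Proof. by rewrite /laurent_poly rmorphD hornerD. Qed.
Lemma laurent_polyN q : laurent_poly (- q) = - laurent_poly q.
Proof. by rewrite /laurent_poly rmorphN hornerN. Qed.
Lemma laurent_polyM q r : laurent_poly (q * r) = laurent_poly q * laurent_poly r.
Proof. by rewrite /laurent_poly rmorphM hornerM. Qed.
Lemma laurent_polyX : laurent_poly 'X = v.
Proof. by rewrite /laurent_poly map_polyX hornerX. Qed.
Lemma laurent_polyXn k : laurent_poly 'X^k = v ^+ k.
Proof. by rewrite /laurent_poly rmorphXn /= map_polyX hornerXn. Qed.
Lemma laurent_polyC c : laurent_poly c%:P = c%:~R.
Proof. by rewrite /laurent_poly map_polyC hornerC. Qed.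

Lemma laurent_val_poly q : laurent_val (laurent_poly q) = FracField.tofrac q.
Proof.
rewrite /laurent_poly -[laurent_val _]/(\val _) -horner_map -map_poly_comp /=.
rewrite -[q in RHS]comp_polyXr /comp_poly -horner_map -map_poly_comp.
congr (_.[_]); apply: eq_map_poly => c /=; rewrite -[laurent_val _]/(\val _) rmorph_int.
by rewrite -[c in RHS]intz !rmorph_int.
Qed.

Lemma laurent_poly_inj : injective laurent_poly.
Proof.
by move=> q r /(congr1 laurent_val); rewrite !laurent_val_poly => /eqP; rewrite tofrac_eq => /eqP.
Qed.

Lemma vV_v_exp k : vV ^+ k * v ^+ k = 1.
Proof. by rewrite -exprMn mulrC v_vV expr1n. Qed.

Lemma laurentP (f : laurent) : exists q k, f = laurent_poly q * vV ^+ k.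
Proof.
have /asboolP[q [k f_q]] := laurent_valP f; exists q, k; apply: val_inj.
rewrite /= laurent_val_poly f_q; congr (_ * _).
by rewrite -[RHS]/(\val _) rmorphXn exprVn.
Qed.

Lemma laurent_mulI (f g h : laurent) : f != 0 -> f * g = f * h -> g = h.
Proof.
move=> f_neq0 /(congr1 laurent_val) /mulfI eq_gh; apply: val_inj; apply: eq_gh.
by apply: contra f_neq0 => /eqP f0; apply/eqP; apply: val_inj.
Qed.

(** Membership in Z[v] together with the constant term, whose vanishing is the
    condition on the coefficients of a Kazhdan-Lusztig element. *)
Definition int_const (f : laurent) (c : int) :=
  exists2 q : {poly int}, f = laurent_poly q & q`_0 = c.

Lemma int_const0 : int_const 0 0.
Proof. by exists 0; rewrite ?coef0 // /laurent_poly rmorph0 horner0. Qed.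

Lemma int_constD f g c d : int_const f c -> int_const g d -> int_const (f + g) (c + d).
Proof. by case=> q -> <- [r -> <-]; exists (q + r); rewrite ?coefD ?laurent_polyD. Qed.

Lemma int_constN f c : int_const f c -> int_const (- f) (- c).
Proof. by case=> q -> <-; exists (- q); rewrite ?coefN ?laurent_polyN. Qed.

Lemma int_const_vM f c : int_const f c -> int_const (v * f) 0.
Proof.
by case=> q -> _; exists ('X * q); rewrite ?coefXM // laurent_polyM laurent_polyX.
Qed.

Lemma int_const_vexp k : int_const (v ^+ k) (k == 0%N)%:R.
Proof. by exists 'X^k; rewrite ?coefXn ?laurent_polyXn // eq_sym; case: eqP. Qed.

Lemma int_const_sum (J : finType) (P : pred J) F c :
  (forall j, P j -> int_const (F j) (c j)) ->
  int_const (\sum_(j | P j) F j) (\sum_(j | P j) c j).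
Proof.
move=> Fc; elim/big_rec2: _ => [|j a b Pj]; first exact: int_const0.
exact/int_constD/Fc.
Qed.

Lemma int_const_in_vZv f : int_const f 0 <-> in_vZv f.
Proof.
split=> [[q -> q0]|[q ->]]; last by apply: (@int_const_vM _ q`_0); exists q.
have /factor_theorem[r ->] : root q 0 by rewrite /root horner_coef0 q0.
by exists r; rewrite subr0 laurent_polyM laurent_polyX mulrC.
Qed.

Lemma int_const_in_vZvB f g : int_const f 0 -> int_const g 0 -> in_vZv (f - g).
Proof.
move=> f0 g0; apply/int_const_in_vZv; rewrite -[0]subr0.
exact: int_constD f0 (int_constN g0).
Qed.

(** After multiplication by v^(s + 1), where s is the size of q, the right-hand
    side has degree at most s while the left-hand side is v^(s + 2) q. *)
Lemma in_vZv_inv q : v * laurent_poly q = vV * (map_poly intr q).[vV] -> q = 0.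
Proof.
move=> eq_q; pose s := size q.
pose r := \poly_(i < s.+1) q`_(s - i).
have rE : v ^+ s * (map_poly intr q).[vV] = laurent_poly r.
  rewrite /laurent_poly (@horner_coef_wide _ s); last by apply: size_poly.
  rewrite (@horner_coef_wide _ s.+1); last first.
    by apply: leq_trans (size_poly _ _) _; apply: size_poly.
  rewrite mulr_sumr big_ord_recl /=.
  rewrite coef_map coef_poly ltnS leq0n subn0 nth_default // mul0r add0r.
  rewrite [RHS](reindex_inj rev_ord_inj) /=; apply: eq_bigr => i _.
  rewrite !coef_map coef_poly /= /bump add1n ltnS.
  have lt_is := ltn_ord i; rewrite subnSK // leq_subr subKn ?(ltnW lt_is) //.
  rewrite mulrCA; congr (_ * _).
  have -> : v ^+ s = v ^+ (s - i) * v ^+ i by rewrite -exprD subnK // ltnW.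
  by rewrite -mulrA [v ^+ i * _]mulrC vV_v_exp mulr1.
have: q * 'X^(s.+2) = r.
  apply: laurent_poly_inj; rewrite laurent_polyM laurent_polyXn -rE mulrC.
  by rewrite exprSr -mulrA eq_q exprSr -mulrA [v * _]mulrA v_vV mul1r.
move/(congr1 (fun p : {poly int} => size p)).
have [->//|q_neq0] := eqVneq q 0.
rewrite size_mulXn // => sz.
have := size_poly s.+1 (fun i => q`_(s - i)); rewrite -/r -sz -/s.
by lia.
Qed.
End LaurentPolynomials.

(** * The bar involution on the standard basis *)

Section HeckeAlgebra.
Variables (I : finType) (adj : rel I) (W : finGroupType).
Hypothesis adj_sym : symmetric adj.
Variable S : coxeterSystem (simply_laced adj) W.
Variables (HH : algType laurent) (H : I -> HH).
Hypothesis hHH : is_hecke_algebra (simply_laced adj) H.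

Local Notation L := laurent.
Local Notation T := (std_basis S H).
Local Notation std_coef := (std_coef adj_sym S hHH).

Lemma std_basisE w : T w = word_act S (fun i h => H i * h) w 1.
Proof.
rewrite /std_basis /word_act; elim: (reduced_word S w) => [|i u IHu].
  by rewrite big_nil.
by rewrite big_cons IHu.
Qed.

Lemma std_basis1 : T 1%g = 1.
Proof. by rewrite /std_basis (size0nil (len1 S)) big_nil. Qed.

Lemma H_sq i : H i * H i = 1 + (vV - v) *: H i.
Proof. by have [/hecke_relationsP-/(_ adj_sym)[_ _ ->]] := hHH. Qed.

Lemma std_basis_up i w : ~~ descent S i w -> T (S i * w)%g = H i * T w.
Proof.
have [/hecke_relationsP-/(_ adj_sym)[comm braid _] _] := hHH.
move=> up_i; rewrite !std_basisE (word_act_up adj_sym) // => [j k x ne_jk nadj_jk|j k x ne_jk adj_jk].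
  by rewrite !mulrA comm.
by rewrite !mulrA braid.
Qed.

Lemma std_basis_down i w : descent S i w ->
  H i * T w = T (S i * w)%g + (vV - v) *: T w.
Proof.
move=> dn_i; rewrite -{1 3}(gen_mulK S i w) std_basis_up ?descent_mul ?dn_i //.
by rewrite mulrA H_sq mulrDl mul1r scalerAl.
Qed.

Lemma std_coef_std w : std_coef (T w) = delta w.
Proof.
elim/(weak_ind (S := S)): w => [|i w up_i IHw]; first by rewrite std_basis1 std_coef1.
by rewrite std_basis_up // std_coefH IHw left_op_delta.
Qed.

Lemma std_coef_lin (c : W -> L) w : std_coef (\sum_y c y *: T y) w = c w.
Proof.
rewrite std_coef_sum (bigD1 w) //= std_coefZ std_coef_std /delta eqxx mulr1 big1 ?addr0 //.
by move=> y /negPf ne_y; rewrite std_coefZ std_coef_std /delta eq_sym ne_y mulr0.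
Qed.

Variable bar : {rmorphism HH -> HH}.
Hypothesis hbar : is_bar_involution H bar.

(** The substitution of v^-1 for v, as a relation: it is read from the action of
    bar on the scalars, which spares the construction of a ring morphism. *)
Definition bar_scalar (f g : L) := bar f%:A = g%:A.

Lemma scalar_inj (f g : L) : f%:A = g%:A :> HH -> f = g.
Proof.
move/(congr1 (fun h => std_coef h 1%g)).
by rewrite !std_coefZ std_coef1 /delta eqxx !mulr1.
Qed.

Lemma bar_scalarD f f' g g' : bar_scalar f g -> bar_scalar f' g' ->
  bar_scalar (f + f') (g + g').
Proof. by rewrite /bar_scalar !scalerDl rmorphD => -> ->. Qed.

Lemma scalar_mulE (f : L) (h : HH) : f *: h = f%:A * h.
Proof. by rewrite -scalerAl mul1r. Qed.

Lemma scalarM (f g : L) : (f * g)%:A = f%:A * g%:A :> HH.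
Proof. by rewrite -scalerA scalar_mulE. Qed.

Lemma bar_scalarM f f' g g' : bar_scalar f g -> bar_scalar f' g' ->
  bar_scalar (f * f') (g * g').
Proof. by rewrite /bar_scalar !scalarM rmorphM => -> ->. Qed.

Lemma bar_scalar_int c : bar_scalar c%:~R c%:~R.
Proof. by rewrite /bar_scalar scaler_int rmorph_int. Qed.

Lemma bar_scalar_v : bar_scalar v vV.
Proof. exact: hbar.1. Qed.

Lemma bar_scalar_vV : bar_scalar vV v.
Proof.
have bar1 : bar v%:A * bar vV%:A = 1 by rewrite -rmorphM -scalarM v_vV scale1r rmorph1.
have vvV : v%:A * vV%:A = 1 :> HH by rewrite -scalarM v_vV scale1r.
by rewrite /bar_scalar -[LHS]mul1r -{1}vvV -mulrA -{1}hbar.1 bar1 mulr1.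
Qed.

Lemma bar_scalar_poly q : bar_scalar (laurent_poly q) (map_poly intr q).[vV].
Proof.
elim/poly_ind: q => [|q c IHq].
  by rewrite /laurent_poly rmorph0 !horner0; exact: (bar_scalar_int 0).
rewrite /laurent_poly !rmorphD !rmorphM /= map_polyX map_polyC !hornerE.
exact: bar_scalarD (bar_scalarM IHq bar_scalar_v) (bar_scalar_int c).
Qed.

Lemma bar_scalar_exists f : exists g, bar_scalar f g.
Proof.
have [q [k ->]] := laurentP f; exists ((map_poly intr q).[vV] * v ^+ k).
apply: bar_scalarM; first exact: bar_scalar_poly.
elim: k => [|k IHk]; first by rewrite !expr0; exact: (bar_scalar_int 1).
by rewrite !exprS; apply: bar_scalarM; [apply: bar_scalar_vV|].
Qed.

Lemma bar_scale f g h : bar_scalar f g -> bar (f *: h) = g *: bar h.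
Proof. by move=> fg; rewrite scalar_mulE rmorphM fg -scalar_mulE. Qed.

Lemma in_vZv_bar_invariant f : in_vZv f -> bar_scalar f f -> f = 0.
Proof.
case=> q f_q; have := bar_scalarM bar_scalar_v (bar_scalar_poly q).
rewrite -[v * _]f_q /bar_scalar => -> /scalar_inj eq_f.
have q0 : q = 0 by apply: in_vZv_inv; rewrite eq_f.
by rewrite f_q q0 rmorph0 horner0 mulr0.
Qed.

Lemma barH i : bar (H i) = H i + (v - vV)%:A.
Proof.
have [bHH HbH] := hbar.2 i; rewrite -[LHS]mulr1.
suff {1}<- : H i * (H i + (v - vV)%:A) = 1 by rewrite mulrA bHH mul1r.
rewrite mulrDr H_sq -scalerAr mulr1 -[v - vV]opprB scaleNr.
by rewrite addrK.
Qed.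

Definition Cgen i : HH := H i + v%:A.

Lemma bar_Cgen i : bar (Cgen i) = Cgen i.
Proof. by rewrite rmorphD /= barH bar_scalar_v -addrA -scalerDl subrK. Qed.

Lemma Cgen_up i w : ~~ descent S i w -> Cgen i * T w = T (S i * w)%g + v *: T w.
Proof. by move=> up_i; rewrite mulrDl -std_basis_up // -scalar_mulE. Qed.

Lemma Cgen_down i w : descent S i w -> Cgen i * T w = T (S i * w)%g + vV *: T w.
Proof.
move=> dn_i; rewrite mulrDl std_basis_down // -scalar_mulE -addrA -scalerDl.
by rewrite subrK.
Qed.

(** The bar involution is unitriangular for the length: bar (H i) is H i plus a
    scalar, and the scalar terms contribute subwords only. *)
Lemma bar_word_coef u x : (size u <= len S x)%N ->
  std_coef (bar (\prod_(i <- u) H i)) x = (x == word_val S u)%:R.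
Proof.
elim: u x => [|i u IHu] x.
  by rewrite /word_val !big_nil rmorph1 std_coef1.
rewrite /= big_cons word_val_cons rmorphM barH mulrDl -scalar_mulE => lt_ux.
have le_sx : (size u <= len S (S i * x)%g)%N.
  by rewrite -ltnS (leq_trans lt_ux) // -{1}(gen_mulK S i x) len_gen_mul.
have x_neq : (x == word_val S u) = false.
  by apply: contraTF lt_ux => /eqP->; rewrite -leqNgt len_word_val.
rewrite std_coefD std_coefZ std_coefH /left_op !IHu // ?(ltnW lt_ux) //.
rewrite x_neq !mulr0 !addr0; congr (_%:R).
by rewrite -(inj_eq (mulgI (S i))) gen_mulK.
Qed.

Lemma bar_std_coef w x : (len S w <= len S x)%N -> std_coef (bar (T w)) x = (x == w)%:R.
Proof. by move=> le_wx; rewrite bar_word_coef // reduced_wordK. Qed.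

Lemma bar_sum (c : W -> L) : exists c' : W -> L,
  (forall y, bar_scalar (c y) (c' y)) /\
  bar (\sum_y c y *: T y) = \sum_y c' y *: bar (T y).
Proof.
exists (fun y => projT1 (cid (bar_scalar_exists (c y)))).
have c'P y : bar_scalar (c y) (projT1 (cid (bar_scalar_exists (c y)))).
  exact: (projT2 (cid (bar_scalar_exists (c y)))).
by split=> //; rewrite rmorph_sum; apply: eq_bigr => y _; rewrite (bar_scale _ (c'P y)).
Qed.

Lemma bar_scalar0 g : bar_scalar 0 g -> g = 0.
Proof. by rewrite /bar_scalar scale0r rmorph0 -(scale0r 1) => /scalar_inj. Qed.

(** An element supported in length at most k keeps this support and its
    coefficients of length k, up to v |-> v^-1. *)
Lemma bar_top_coef (c : W -> L) y :
  (forall z, (len S y < len S z)%N -> c z = 0) ->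
  bar_scalar (c y) (std_coef (bar (\sum_z c z *: T z)) y).
Proof.
move=> c0; have [c' [cc' ->]] := bar_sum c.
rewrite std_coef_sum (bigD1 y) //= std_coefZ bar_std_coef // eqxx mulr1.
rewrite big1 ?addr0 // => z /negPf ne_zy; rewrite std_coefZ.
have [le_zy|lt_yz] := leqP (len S z) (len S y).
  by rewrite bar_std_coef // eq_sym ne_zy mulr0.
by have := cc' z; rewrite c0 // => /bar_scalar0->; rewrite mul0r.
Qed.

(** The uniqueness of the Kazhdan-Lusztig basis: a nonzero coefficient of
    maximal length would be invariant under v |-> v^-1 and divisible by v. *)
Lemma bar_invariant_eq0 (c : W -> L) :
  (forall y, in_vZv (c y)) ->
  let h := \sum_y c y *: T y in
  std_coef (bar h) = std_coef h -> forall y, c y = 0.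
Proof.
move=> c_vZv h bar_h y.
have [k] := ubnP (len S (longest S) - len S y); elim: k y => // k IHk y lt_y.
apply: in_vZv_bar_invariant => //.
rewrite -{2}(std_coef_lin c y) -[\sum_z _]/h -bar_h; apply: bar_top_coef => z lt_yz.
apply: IHk; move: lt_y lt_yz.
by have := len_longest S z; have := len_longest S y; lia.
Qed.
End HeckeAlgebra.

(** * The reflection representation of the Hecke algebra *)

Section ReflectionRepresentation.
Variables (I : finType) (adj : rel I) (W : finGroupType).
Hypothesis adj_sym : symmetric adj.
Hypothesis adj_irr : irreflexive adj.
Variable S : coxeterSystem (simply_laced adj) W.
Local Notation L := laurent.
Local Notation q := (v + vV).

Definition cartan_pairing i (x : I -> L) : L := q * x i - \sum_(k | adj i k) x k.
Definition unit_vec i : I -> L := fun k => (k == i)%:R.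
Definition refl_op := reflop v cartan_pairing unit_vec.

Lemma sum_unit_vec i k : \sum_(l | adj i l) unit_vec k l = (adj i k)%:R.
Proof.
rewrite /unit_vec; have [adj_ik|nadj_ik] := boolP (adj i k).
  by rewrite (bigD1 k) //= eqxx big1 ?addr0 // => l /andP[_ /negPf->].
by rewrite big1 // => l adj_il; case: eqP => // lk; rewrite lk (negPf nadj_ik) in adj_il.
Qed.

Lemma cartan_row_op i j x : cartan_pairing i (refl_op j x) =
  v * cartan_pairing i x - cartan_pairing j x * (q * (i == j)%:R - (adj i j)%:R).
Proof.
have -> : cartan_pairing i (refl_op j x) = q * (refl_op j x i) -
    (v * (\sum_(k | adj i k) x k) - cartan_pairing j x * \sum_(k | adj i k) unit_vec j k).
  by rewrite /cartan_pairing !mulr_sumr -sumrB.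
by rewrite sum_unit_vec /refl_op reflopE [cartan_pairing i x]/cartan_pairing /unit_vec; ring.
Qed.

Lemma refl_op_comm i j x : i != j -> ~~ adj i j -> refl_op i (refl_op j x) = refl_op j (refl_op i x).
Proof.
apply: reflop_comm adj_sym _ i j x => i j x ne_ij nadj_ij.
by rewrite -/refl_op cartan_row_op (negPf ne_ij) (negPf nadj_ij) /=; ring.
Qed.

Lemma refl_op_braid i j x : i != j -> adj i j ->
  refl_op i (refl_op j (refl_op i x)) = refl_op j (refl_op i (refl_op j x)).
Proof.
apply: (reflop_braid (a' := vV)) i j x => //; first exact: v_vV.
  by move=> i x; rewrite -/refl_op cartan_row_op eqxx adj_irr /=; ring.
move=> i j x ne_ij adj_ij.
by rewrite -/refl_op cartan_row_op (negPf ne_ij) adj_ij /=; ring.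
Qed.

Definition refl_act w (x : I -> L) : I -> L := word_act S refl_op w x.

(** The extension of the reflection representation by the character
    H_i |-> v, in which the node j couples to the extra coordinate None. *)
Section Extension.
Variable j : I.

Definition ext_row i (x : option I -> L) : L :=
  cartan_pairing i (fun k => x (Some k)) - (i == j)%:R * x None.
Definition ext_unit i : option I -> L := fun k => (k == Some i)%:R.
Definition ext_op := reflop v ext_row ext_unit.

Lemma ext_row_op i k x : ext_row i (ext_op k x) =
  v * ext_row i x - ext_row k x * (q * (i == k)%:R - (adj i k)%:R).
Proof.
have -> : ext_row i (ext_op k x) = q * (ext_op k x (Some i)) -
    (v * (\sum_(l | adj i l) x (Some l)) - ext_row k x * \sum_(l | adj i l) unit_vec k l)
    - (i == j)%:R * ext_op k x None.
  by rewrite {1}/ext_row /cartan_pairing !mulr_sumr -sumrB.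
rewrite sum_unit_vec /ext_op !reflopE [ext_row i x]/ext_row /cartan_pairing.
by rewrite /ext_unit /= (inj_eq Some_inj); ring.
Qed.

Lemma ext_op_comm i k x : i != k -> ~~ adj i k ->
  ext_op i (ext_op k x) = ext_op k (ext_op i x).
Proof.
apply: reflop_comm adj_sym _ i k x => i k x ne_ik nadj_ik.
by rewrite -/ext_op ext_row_op (negPf ne_ik) (negPf nadj_ik) /=; ring.
Qed.

Lemma ext_op_braid i k x : i != k -> adj i k ->
  ext_op i (ext_op k (ext_op i x)) = ext_op k (ext_op i (ext_op k x)).
Proof.
apply: (reflop_braid (a' := vV)) i k x => //; first exact: v_vV.
  by move=> i x; rewrite -/ext_op ext_row_op eqxx adj_irr /=; ring.
move=> i k x ne_ik adj_ik.
by rewrite -/ext_op ext_row_op (negPf ne_ik) adj_ik /=; ring.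
Qed.

Definition ext_act w := word_act S ext_op w (fun k => (k == None)%:R).

(** The entry (i, j) of the matrix G(y): the coefficient at y w0 of the element
    of the penultimate cell with left ascent i and root j. *)
Definition pen_coef (y : W) (i : I) : L := ext_act y (Some i).

Lemma ext_act_up i y : ~~ descent S i y -> ext_act (S i * y)%g = ext_op i (ext_act y).
Proof.
by move=> up_i; apply: (word_act_up adj_sym) => //;
  [apply: ext_op_comm | apply: ext_op_braid].
Qed.

Lemma ext_act1 : ext_act 1%g = fun k => (k == None)%:R.
Proof. by apply: (word_act1 adj_sym); [apply: ext_op_comm | apply: ext_op_braid]. Qed.

Lemma ext_act_None y : ext_act y None = v ^+ len S y.
Proof.
elim/(weak_ind (S := S)): y => [|i y up_i IHy]; first by rewrite ext_act1 len1.
by rewrite ext_act_up // /ext_op reflopE IHy len_up // exprS /ext_unit mulr0 subr0.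
Qed.

Lemma pen_coef1 i : pen_coef 1%g i = 0.
Proof. by rewrite /pen_coef ext_act1. Qed.

Lemma pen_coef_up_ne i k y : ~~ descent S i y -> k != i -> pen_coef (S i * y)%g k = v * pen_coef y k.
Proof.
move=> up_i ne_ki; rewrite /pen_coef ext_act_up // /ext_op reflopE /ext_unit.
by rewrite (inj_eq Some_inj) (negPf ne_ki) mulr0 subr0.
Qed.

Lemma pen_coef_up i y : ~~ descent S i y -> pen_coef (S i * y)%g i =
  - vV * pen_coef y i + \sum_(k | adj i k) pen_coef y k + (i == j)%:R * v ^+ len S y.
Proof.
move=> up_i; rewrite /pen_coef ext_act_up // /ext_op reflopE /ext_unit eqxx mulr1.
rewrite /ext_row /cartan_pairing ext_act_None.
by move: (v ^+ _) (ext_act y _) (\sum_(k | _) _) => p g c; ring.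
Qed.
End Extension.

Lemma refl_act_up i y x : ~~ descent S i y -> refl_act (S i * y)%g x = refl_op i (refl_act y x).
Proof.
by move=> up_i; apply: (word_act_up adj_sym) => //; [apply: refl_op_comm | apply: refl_op_braid].
Qed.

Lemma refl_act1 x : refl_act 1%g x = x.
Proof. by apply: (word_act1 adj_sym); [apply: refl_op_comm | apply: refl_op_braid]. Qed.

Lemma refl_act_mul w w' x : len S (w * w')%g = (len S w + len S w')%N ->
  refl_act (w * w')%g x = refl_act w (refl_act w' x).
Proof.
by move=> len_ww'; apply: (word_act_mul adj_sym) => //; [apply: refl_op_comm | apply: refl_op_braid].
Qed.

Lemma refl_act_reduced u x : reduced S u -> refl_act (word_val S u) x = foldr refl_op x u.
Proof.
by move=> red_u; apply: (word_act_reduced adj_sym) => //; [apply: refl_op_comm | apply: refl_op_braid].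
Qed.

(** The relation G(y) A = v^l(y) - Q_y: both sides vanish at y = 1 and obey the
    same recursion, as e_i A_i = v - Q_i. *)
Lemma pen_coef_cartan y b i : q * pen_coef b y i - \sum_(j | adj b j) pen_coef j y i =
  v ^+ len S y * (i == b)%:R - refl_act y (unit_vec b) i.
Proof.
elim/(weak_ind (S := S)): y i => [|s y up_s IHy] i.
  rewrite refl_act1 len1 mul1r subrr pen_coef1 mulr0 big1 ?subr0 // => j _; exact: pen_coef1.
rewrite refl_act_up // len_up // /refl_op reflopE /unit_vec.
have [->|ne_is] := eqVneq i s; last first.
  rewrite pen_coef_up_ne // mulr0 subr0; under eq_bigr => j _ do rewrite pen_coef_up_ne //.
  rewrite -mulr_sumr mulrCA -mulrBr IHy exprS.
  by move: (v ^+ _) (refl_act _ _ _) (_ == b) => p c e; ring.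
rewrite pen_coef_up // [\sum_(j | adj b j) pen_coef j _ _](eq_bigr _ (fun j _ => pen_coef_up j up_s)).
have sum_IH : \sum_(k | adj s k) (q * pen_coef b y k - \sum_(j | adj b j) pen_coef j y k) =
    v ^+ len S y * (adj s b)%:R - \sum_(k | adj s k) refl_act y (unit_vec b) k.
  under eq_bigr => k _ do rewrite IHy.
  by rewrite sumrB -mulr_sumr sum_unit_vec.
rewrite sumrB -mulr_sumr exchange_big /= in sum_IH.
rewrite !big_split /= -mulr_sumr -mulr_suml.
have -> : \sum_(j | adj b j) (s == j)%:R = (adj s b)%:R :> L.
  by under eq_bigr => j _ do rewrite eq_sym; rewrite sum_unit_vec adj_sym.
have := IHy s; rewrite exprS /cartan_pairing mulr1.
set g := \sum_(j | adj b j) pen_coef j y s; set gg := \sum_(j | _) \sum_(k | _) _ in sum_IH *.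
move: sum_IH; set gb := \sum_(k | _) pen_coef b y k; set Qk := \sum_(k | _) refl_act _ _ _.
move=> sum_IH IHs.
have -> : gg = q * gb - (v ^+ len S y * (adj s b)%:R - Qk) by rewrite -sum_IH; ring.
have -> : g = q * pen_coef b y s - (v ^+ len S y * (s == b)%:R - refl_act y (unit_vec b) s).
  by rewrite -IHs; ring.
move: (v ^+ _) (refl_act _ _ _) (pen_coef b y s) => p c g'.
have vvV := v_vV; case: (s == b); case: (adj s b) => /=; ring: vvV.
Qed.

End ReflectionRepresentation.

(** * Constant terms on a tree *)

Section RootedTree.
Variables (I : finType) (adj : rel I) (W : finGroupType).
Hypothesis adj_sym : symmetric adj.
Hypothesis adj_irr : irreflexive adj.
Variable S : coxeterSystem (simply_laced adj) W.
Variables (j : I) (par : I -> I) (dep : I -> nat) (sigma : I -> W).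
Hypothesis adj_par : forall i, i != j -> adj i (par i).
Hypothesis dep_root : dep j = 0%N.
Hypothesis dep_par : forall i, i != j -> dep i = (dep (par i)).+1.
Hypothesis adj_tree : forall i k, adj i k -> (i != j /\ k = par i) \/ (k != j /\ i = par k).
Hypothesis sigma_root : sigma j = S j.
Hypothesis sigma_par : forall i, i != j -> sigma i = (S i * sigma (par i))%g.

(** A descent t <> i of sigma i would be the parent p of i, by induction applied
    to sigma p.  Then t is adjacent to i, so that i is a descent of the next
    element sigma (par p), hence i = par p, which contradicts the depths. *)
Lemma sigma_len_descent i :
  len S (sigma i) = (dep i).+1 /\ forall t, descent S t (sigma i) = (t == i).
Proof.
have [k] := ubnP (dep i); elim: k i => // k IHk i lt_i.
have [->|ne_ij] := eqVneq i j.
  rewrite sigma_root dep_root; split=> [|t]; last first.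
    by rewrite /descent eta_gen (inj_eq (gen_inj adj_sym (S := S))).
  by rewrite -[S j]mulg1 len_up ?len1 ?descent1.
have dep_i := dep_par ne_ij; set p := par i in dep_i.
have [len_p dn_p] : len S (sigma p) = (dep p).+1 /\ forall t, descent S t (sigma p) = (t == p).
  by apply: IHk; rewrite -dep_i.
have ne_ip : i != p by apply/eqP=> eq_ip; move: dep_i; rewrite -eq_ip; lia.
have up_i : ~~ descent S i (sigma p) by rewrite dn_p.
rewrite sigma_par //; split=> [|t]; first by rewrite len_up // len_p dep_i.
have [->|ne_ti] := eqVneq t i; first by rewrite descent_mul.
apply/negP=> dn_t; have dn_i : descent S i (S i * sigma p) by rewrite descent_mul.
have ne_it : i != t by rewrite eq_sym.
have [adj_it|nadj_it] := boolP (adj i t).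
  have [u red_u] := two_descents_adj adj_sym ne_it adj_it dn_i dn_t.
  rewrite word_val_cons => /mulgI u_p.
  have tp : t = p.
    apply/eqP; rewrite -dn_p -u_p; apply/descent_reduced/reduced_len.
    exact: reduced_behead red_u.
  have len_u : (size u).+2 = len S (sigma p).
    rewrite -u_p -[_.+2]/(size [:: t, i & u]); apply/esym/reduced_len.
    exact: reduced_behead red_u.
  have ne_pj : p != j.
    by apply/eqP=> pj; move: len_u; rewrite len_p pj dep_root.
  have dep_p := dep_par ne_pj.
  have [_ dn_pp] : len S (sigma (par p)) = (dep (par p)).+1 /\
      forall t, descent S t (sigma (par p)) = (t == par p).
    by apply: IHk; move: lt_i; rewrite dep_i dep_p; lia.
  have : descent S i (sigma (par p)).
    move: u_p; rewrite word_val_cons sigma_par // tp => /mulgI<-.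
    apply/descent_reduced/reduced_len.
    exact: (reduced_behead (reduced_behead red_u)).
  rewrite dn_pp => /eqP i_pp; move: dep_i; rewrite dep_p -i_pp; lia.
have [u red_u] := two_descents_exchange adj_sym ne_it dn_i dn_t.
rewrite word_val_cons => /mulgI u_p.
have tp : t = p.
  apply/eqP; rewrite -dn_p -u_p; apply/descent_reduced/reduced_len.
  exact: reduced_behead red_u.
by move: nadj_it; rewrite tp adj_par.
Qed.

Lemma sigma_len i : len S (sigma i) = (dep i).+1.
Proof. by have [] := sigma_len_descent i. Qed.

Lemma sigma_descent i t : descent S t (sigma i) = (t == i).
Proof. by have [] := sigma_len_descent i. Qed.

Lemma sigma_inj : injective sigma.
Proof. by move=> i k eq_ik; apply/eqP; rewrite -sigma_descent -eq_ik sigma_descent. Qed.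

Definition cut i := (S i * sigma i)%g.

Lemma sigma_cut i : sigma i = (S i * cut i)%g.
Proof. by rewrite gen_mulK. Qed.

Lemma len_cut i : len S (cut i) = dep i.
Proof.
apply/eqP; rewrite -eqSS -sigma_len /cut -len_down //.
by rewrite sigma_descent.
Qed.

(** This is the recursion of [pen_coef_up] for constant terms.  At most one
    neighbour k of i has y = sigma k.  If k is the parent of i then
    s_i y = sigma i; if i is the parent of k then s_t y = sigma i and the two
    terms on the right cancel.  Without such a k both sides vanish, since
    y = s_t sigma i would have the descent i. *)
Lemma sigma_recursion i t y : y != 1%g -> t != i -> descent S t y -> ~~ descent S i y ->
  (S i * y == sigma i)%g%:R =
  - (S t * y == sigma i)%g%:R + \sum_(k | adj i k) (y == sigma k)%:R :> int.
Proof.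
move=> ne_y1 ne_ti dn_t up_i.
have [[k adj_ik y_k]|no_k] := pselect (exists2 k, adj i k & y = sigma k).
  rewrite (bigD1 k) //= big1 => [|l /andP[_ ne_lk]]; last first.
    by rewrite y_k (inj_eq sigma_inj) eq_sym (negPf ne_lk).
  rewrite y_k eqxx addr0.
  have tk : t = k by apply/eqP; rewrite -sigma_descent -y_k.
  have [[ne_ij def_k]|[ne_kj def_i]] := adj_tree adj_ik.
    rewrite (sigma_par ne_ij) -def_k eqxx.
    case: eqP => // eq_ti; have := len_down dn_t; have := len_up up_i.
    by rewrite y_k eq_ti; lia.
  rewrite tk (sigma_par ne_kj) gen_mulK def_i eqxx -def_i.
  case: eqP => // eq_i; have := len_up up_i.
  by rewrite {1}y_k (sigma_par ne_kj) -def_i eq_i y_k !sigma_len (dep_par ne_kj) -def_i; lia.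
rewrite big1 => [|k adj_ik]; last by case: eqP => // y_k; case: no_k; exists k.
have -> : (S i * y == sigma i)%g = false.
  apply/eqP=> iy; have y_cut : y = cut i by rewrite /cut -iy gen_mulK.
  have [eq_ij|ne_ij] := eqVneq i j.
    by move: ne_y1; rewrite y_cut /cut eq_ij sigma_root gen_sq eqxx.
  case: no_k; exists (par i); first exact: adj_par.
  by rewrite y_cut /cut sigma_par // gen_mulK.
case: eqP => // ty; rewrite ?oppr0 //.
have len_y := len_down dn_t; rewrite ty sigma_len in len_y.
have y_t : y = (S t * S i * cut i)%g by rewrite -mulgA -sigma_cut -ty gen_mulK.
have len_iy := len_up up_i; rewrite len_y in len_iy.
have [adj_it|nadj_it] := boolP (adj i t); last first.
  have ne_it : i != t by rewrite eq_sym.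
  have iy : (S i * y = S t * cut i)%g.
    by rewrite y_t !mulgA (comm_rel S ne_it nadj_it) -(mulgA _ (S i) (S i)) gen_sq mulg1.
  by have := len_gen_mul S t (cut i); rewrite -iy len_iy len_cut; lia.
have [[ne_ij def_t]|[ne_tj def_i]] := adj_tree adj_it; last first.
  case: no_k; exists t => //.
  by rewrite sigma_par // -def_i -ty gen_mulK.
have := len_gen_mul S t (S i * cut t); have := len_gen_mul S i (cut t).
rewrite len_cut => len1 len2.
have iy : (S i * y = S t * (S i * cut t))%g.
  rewrite y_t {1}/cut (sigma_par ne_ij) -def_t gen_mulK {1}(sigma_cut t).
  move: (cut t) => z; rewrite !mulgA (braid_rel S adj_it).
  by rewrite -(mulgA _ (S t) (S t)) gen_sq mulg1.
by move: len_iy; rewrite iy (dep_par ne_ij) -def_t; lia.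
Qed.

(** A factor v appears at i whenever y has a descent t <> i, so that constant
    terms survive only through the recursion at the descent i. *)
Lemma pen_coef_const y i : int_const (pen_coef S j y i) (y == sigma i)%:R.
Proof.
have [k] := ubnP (len S y); elim: k y i => // k IHk y i lt_y.
have sigma_neq1 l : (1 == sigma l)%g = false.
  by apply/eqP=> s1; have := sigma_len l; rewrite -s1 len1.
have [y1|ne_y1] := eqVneq y 1%g.
  by rewrite y1 pen_coef1 // sigma_neq1; exact: int_const0.
have [dn_i|up_i] := boolP (descent S i y); last first.
  have [t dn_t] := descent_exists S ne_y1.
  have ne_it : i != t by apply: contraNneq up_i => ->.
  have -> : (y == sigma i) = false.
    by apply: contraTF dn_t => /eqP->; rewrite sigma_descent eq_sym.
  rewrite -(gen_mulK S t y) pen_coef_up_ne ?descent_mul ?dn_t //.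
  by apply: (@int_const_vM _ (S t * y == sigma i)%g%:R); apply: IHk; rewrite -ltnS -len_down.
set y' := (S i * y)%g; have up_y' : ~~ descent S i y' by rewrite descent_mul dn_i.
have def_y : y = (S i * y')%g by rewrite gen_mulK.
have lt_y' : (len S y' < k)%N by rewrite -ltnS -len_down.
rewrite {1}def_y pen_coef_up //.
have [y'1|ne_y'1] := eqVneq y' 1%g.
  rewrite y'1 pen_coef1 // mulr0 add0r big1 ?add0r => [|l _]; last exact: pen_coef1.
  rewrite len1 mulr1 def_y y'1 mulg1.
  have [->|ne_ij] := eqVneq i j.
    by rewrite sigma_root eqxx; apply: (int_const_vexp 0).
  suff -> : (S i == sigma i) = false by exact: int_const0.
  apply/eqP=> s_i; have := sigma_len i; rewrite -s_i -[S i]mulg1 len_up ?descent1 // len1.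
  by rewrite dep_par.
have [t dn_t] := descent_exists S ne_y'1.
have ne_ti : t != i by apply: contraNneq up_y' => <-.
rewrite def_y (sigma_recursion ne_y'1 ne_ti) // -[X in int_const _ X]addr0.
apply: int_constD; last first.
  case: (i == j); rewrite ?mul1r ?mul0r; last exact: int_const0.
  have := int_const_vexp (len S y'); rewrite (len_down dn_t); exact.
apply: int_constD; last by apply: int_const_sum => l _; apply: IHk.
have -> : pen_coef S j y' i = v * pen_coef S j (S t * y')%g i.
  by rewrite -{1}(gen_mulK S t y') pen_coef_up_ne ?descent_mul ?dn_t // eq_sym.
rewrite mulrA mulNr [vV * v]mulrC v_vV mulN1r; apply: int_constN.
by apply: IHk; apply: leq_trans lt_y'; rewrite (len_down dn_t) ltnW.
Qed.
End RootedTree.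

(** * The Kazhdan-Lusztig elements of the penultimate cell *)

Section PenultimateCell.
Variables (I : finType) (adj : rel I) (W : finGroupType).
Hypothesis adj_sym : symmetric adj.
Hypothesis adj_irr : irreflexive adj.
Variable S : coxeterSystem (simply_laced adj) W.
Variables (HH : algType laurent) (H : I -> HH).
Hypothesis hHH : is_hecke_algebra (simply_laced adj) H.
Variable bar : {rmorphism HH -> HH}.
Hypothesis hbar : is_bar_involution H bar.

Local Notation L := laurent.
Local Notation T := (std_basis S H).
Local Notation std_coef := (std_coef adj_sym S hHH).
Local Notation w0 := (longest S).
Local Notation C := (Cgen H).
Local Notation q := (v + vV).

Lemma Cgen_lin i (f : W -> L) : C i * \sum_z f z *: T z =
  \sum_z (f (S i * z)%g + (if descent S i z then vV else v) * f z) *: T z.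
Proof.
rewrite mulr_sumr.
transitivity (\sum_z (f z *: T (S i * z)%g + ((if descent S i z then vV else v) * f z) *: T z)).
  apply: eq_bigr => z _; rewrite -scalerAr; case: ifP => [dn_i|/negbT up_i].
    by rewrite Cgen_down // scalerDr scalerA mulrC.
  by rewrite Cgen_up // scalerDr scalerA mulrC.
rewrite big_split /= (reindex_inj (mulgI (S i))) -big_split /=.
by apply: eq_bigr => z _; rewrite gen_mulK scalerDl.
Qed.

(** The Kazhdan-Lusztig element of w0. *)
Definition Clong : HH := \sum_z v ^+ len S (z * w0)%g *: T z.
Definition Cpen j i : HH := \sum_z pen_coef S j (z * w0)%g i *: T z.

Lemma Cgen_Clong i : C i * Clong = q *: Clong.
Proof.
rewrite Cgen_lin scaler_sumr; apply: eq_bigr => z _; rewrite scalerA -mulgA.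
congr (_ *: _); have dn_z := descent_mul_longest S i z.
case: ifP dn_z => [dn_i|/negbT up_i] /= up_z.
  by rewrite len_up ?up_z // exprS -mulrDl.
rewrite [X in _ + v * v ^+ X](len_down (i := i)) ?up_z //.
rewrite (_ : len S (z * w0)%g = (len S (S i * (z * w0))%g).+1); last first.
  by apply: len_down; rewrite up_z.
rewrite exprS; move: (v ^+ _) => p; have vvV := v_vV; ring: vvV.
Qed.

Lemma Cgen_Cpen_ne j i k : k != i -> C i * Cpen j k = q *: Cpen j k.
Proof.
move=> ne_ki; rewrite Cgen_lin scaler_sumr; apply: eq_bigr => z _; rewrite scalerA -mulgA.
congr (_ *: _); have := descent_mul_longest S i z; move: (z * w0)%g => y.
case: ifP => [dn_i|/negbT up_i] /= dn_y.
  by rewrite pen_coef_up_ne ?dn_y // mulrDl.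
rewrite -{2 3}(gen_mulK S i y) pen_coef_up_ne ?descent_mul ?dn_y //.
move: (pen_coef _ _ _ _) => g; have vvV := v_vV; ring: vvV.
Qed.

Lemma Cgen_Cpen j i :
  C i * Cpen j i = \sum_(k | adj i k) Cpen j k + (i == j)%:R *: Clong.
Proof.
rewrite Cgen_lin exchange_big /= scaler_sumr -big_split /=; apply: eq_bigr => z _.
rewrite scalerA -scaler_suml -scalerDl -mulgA; congr (_ *: _).
have := descent_mul_longest S i z; move: (z * w0)%g => y.
case: ifP => [dn_i|/negbT up_i] /= dn_y.
  rewrite pen_coef_up ?dn_y //; move: (pen_coef _ _ _ _) (v ^+ _) (\sum_(k | _) _) => g p s; ring.
rewrite -{2 3 4}(gen_mulK S i y); set y' := (S i * y)%g.
have up_y' : ~~ descent S i y' by rewrite descent_mul dn_y.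
rewrite pen_coef_up // len_up //.
have -> : \sum_(k | adj i k) pen_coef S j (S i * y')%g k = v * \sum_(k | adj i k) pen_coef S j y' k.
  rewrite mulr_sumr; apply: eq_bigr => k adj_ik; rewrite pen_coef_up_ne //.
  by apply: contraTneq adj_ik => ->; rewrite adj_irr.
rewrite exprS; move: (pen_coef _ _ _ _) (v ^+ _) (\sum_(k | _) _) => g p s.
have vvV := v_vV; ring: vvV.
Qed.

Lemma std_coef_Cgen i h x : std_coef (C i * h) x =
  std_coef h (S i * x)%g + (if descent S i x then vV else v) * std_coef h x.
Proof.
rewrite mulrDl -scalar_mulE std_coefD std_coefZ std_coefH /left_op.
by case: (descent S i x) => /=; ring.
Qed.

(** The coefficient of C_i h at x involves those of h at x and at s_i x only,
    so that vanishing propagates from w0 down the weak order. *)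
Lemma vanish_downward (J : Type) (h : J -> HH) :
    (forall i k x, (forall l, std_coef (h l) x = 0) -> std_coef (C i * h k) x = 0) ->
    (forall k, std_coef (h k) w0 = 0) ->
  forall x k, std_coef (h k) x = 0.
Proof.
move=> stable h_w0 x; rewrite -(longest_mulK S x).
elim/(weak_ind (S := S)): (x * w0)%g => [|i y up_i IHy] k; first by rewrite mul1g.
have := stable i k _ IHy; rewrite std_coef_Cgen IHy mulr0 addr0 mulgA; exact.
Qed.

Lemma std_coef_eqB h h' : (forall x, std_coef (h - h') x = 0) -> std_coef h = std_coef h'.
Proof. by move=> eq_h; apply/funext=> x; apply/eqP; rewrite -subr_eq0 -std_coefB eq_h. Qed.

Lemma bar_q h : bar (q *: h) = q *: bar h.
Proof.
apply: bar_scale; rewrite addrC -[X in bar_scalar _ _ X]addrC.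
apply: bar_scalarD; first exact: bar_scalar_vV hbar.
exact: bar_scalar_v hbar.
Qed.

Lemma longer_than_longest (c : W -> L) z : (len S w0 < len S z)%N -> c z = 0.
Proof. by rewrite ltnNge len_longest. Qed.

Lemma bar_Clong : std_coef (bar Clong) = std_coef Clong.
Proof.
apply: std_coef_eqB => x; pose h (_ : unit) := bar Clong - Clong.
apply: (@vanish_downward unit h _ _ x tt) => [i k y h0|u].
  have eqC : C i * h k = q *: h k.
    by rewrite mulrBr Cgen_Clong -{1}(bar_Cgen adj_sym hHH hbar) -rmorphM Cgen_Clong bar_q -scalerBr.
  by rewrite eqC std_coefZ h0 mulr0.
have := bar_top_coef adj_sym hHH hbar (@longer_than_longest (fun z => v ^+ len S (z * w0)%g)).
rewrite longest_sq len1 expr0 std_coefB std_coef_lin longest_sq len1 expr0.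
move=> bar1; apply/eqP; rewrite subr_eq0; apply/eqP; apply: (scalar_inj adj_sym S hHH).
by rewrite -bar1 -[1]/(1%:~R); apply: bar_scalar_int.
Qed.

Lemma bar_Cpen j i : std_coef (bar (Cpen j i)) = std_coef (Cpen j i).
Proof.
apply: std_coef_eqB => x; pose h k := bar (Cpen j k) - Cpen j k.
apply: (@vanish_downward I h _ _ x i) => [s k y h0|k].
  have [->|ne_ks] := eqVneq k s; last first.
    have eqC : C s * h k = q *: h k.
      by rewrite mulrBr (Cgen_Cpen_ne _ ne_ks) -{1}(bar_Cgen adj_sym hHH hbar) -rmorphM (Cgen_Cpen_ne _ ne_ks) bar_q -scalerBr.
    by rewrite eqC std_coefZ h0 mulr0.
  have eqC : C s * h s = \sum_(k | adj s k) h k + (s == j)%:R *: (bar Clong - Clong).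
    rewrite mulrBr Cgen_Cpen -{1}(bar_Cgen adj_sym hHH hbar) -rmorphM Cgen_Cpen rmorphD rmorph_sum.
    rewrite /h sumrB scalerBr; case: (s == j).
      by rewrite !scale1r opprD addrACA.
    by rewrite !scale0r rmorph0 opprD addrACA.
  rewrite eqC std_coefD std_coefZ std_coef_sum big1 ?add0r => [|l _]; last exact: h0.
  by rewrite std_coefB bar_Clong subrr mulr0.
have := bar_top_coef adj_sym hHH hbar (@longer_than_longest (fun z => pen_coef S j (z * w0)%g k)).
rewrite longest_sq pen_coef1 // std_coefB std_coef_lin longest_sq pen_coef1 // subr0.
exact: (bar_scalar0 adj_sym S hHH).
Qed.

Variables (p : W -> W -> L).
Hypothesis hp : is_KL_family S H bar p.

Section Root.
Variables (j : I) (par : I -> I) (dep : I -> nat) (sigma : I -> W).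
Hypothesis adj_par : forall i, i != j -> adj i (par i).
Hypothesis dep_root : dep j = 0%N.
Hypothesis dep_par : forall i, i != j -> dep i = (dep (par i)).+1.
Hypothesis adj_tree : forall i k, adj i k -> (i != j /\ k = par i) \/ (k != j /\ i = par k).
Hypothesis sigma_root : sigma j = S j.
Hypothesis sigma_par : forall i, i != j -> sigma i = (S i * sigma (par i))%g.

(** The Kazhdan-Lusztig element minus [Cpen] is bar invariant with coefficients
    in v Z[v], hence 0; the coefficients are compared at the identity. *)
Lemma KL_penultimate i : ((dep i).+1 < len S w0)%N ->
  p 1%g (sigma i * w0)%g = pen_coef S j w0 i.
Proof.
move=> lt_i; set w := (sigma i * w0)%g.
have const := pen_coef_const adj_sym adj_irr adj_par dep_root dep_par adj_tree sigma_root sigma_par.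
have w_neq1 : (1%g == w) = false.
  apply/eqP=> w1; have := sigma_len adj_sym adj_par dep_root dep_par sigma_root sigma_par i.
  by rewrite -[sigma i](longest_mulK S) -/w -w1 mul1g; lia.
pose c y := if y == w then 1 else if bruhat_lt S y w then p y w else 0.
have [bar_c p_vZv] := hp w.
set Cw := (T w + _) in bar_c.
have def_Cw : Cw = \sum_y c y *: T y.
  rewrite (bigD1 w) //= /c eqxx scale1r; congr (_ + _).
  rewrite [RHS](bigID (fun y => bruhat_lt S y w)) /= [X in _ + X]big1 ?addr0.
    apply: eq_big => [y|y lt_y]; first by rewrite /bruhat_lt; case: eqP.
    by rewrite lt_y; case: eqP lt_y => [->|//]; rewrite /bruhat_lt eqxx.
  by move=> y /andP[/negPf-> /negPf->]; rewrite scale0r.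
pose d y := c y - pen_coef S j (y * w0)%g i.
have d_vZv y : in_vZv (d y).
  rewrite /d /c; case: eqP => [->|ne_y].
    apply/int_const_in_vZv; rewrite -[0](subrr 1); apply: int_constD.
      by exists 1; rewrite ?coef1 // -polyC1 laurent_polyC.
    by apply: int_constN; have := const (w * w0)%g i; rewrite longest_mulK eqxx.
  have G0 : int_const (pen_coef S j (y * w0)%g i) 0.
    have := const (y * w0)%g i; case: eqP => // eq_y.
    by case: ne_y; rewrite /w -eq_y longest_mulK.
  case: ifP => [lt_y|_]; last by apply: int_const_in_vZvB => //; apply: int_const0.
  by apply: int_const_in_vZvB => //; apply/int_const_in_vZv/p_vZv.
have sum_d : \sum_y d y *: T y = Cw - Cpen j i.
  by rewrite def_Cw -sumrB; apply: eq_bigr => y _; rewrite scalerBl.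
have /eqP : d 1%g = 0.
  apply: (bar_invariant_eq0 (S := S) (adj_sym := adj_sym) (hHH := hHH) hbar d_vZv).
  rewrite sum_d rmorphB bar_c.
  by apply/funext=> x; rewrite !std_coefB bar_Cpen.
rewrite /d /c w_neq1 mul1g subr_eq0 => /eqP<-.
by rewrite /bruhat_lt w_neq1 /= bruhat_ge1.
Qed.
End Root.
End PenultimateCell.

(** * The numbers game *)

Section NumbersGame.
Variables (I : finType) (adj : rel I) (W : finGroupType).
Hypothesis adj_sym : symmetric adj.
Variable S : coxeterSystem (simply_laced adj) W.
Variables (K : Type) (al : I -> (K -> int) -> int) (root : I -> K -> int).

Definition game_op := reflop 1 al root.

Hypothesis al_diag : forall i x, al i (game_op i x) = - 1 * al i x.
Hypothesis al_adj : forall i j x, i != j -> adj i j ->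
  al i (game_op j x) = 1 * al i x + al j x.
Hypothesis al_nadj : forall i j x, i != j -> ~~ adj i j ->
  al i (game_op j x) = 1 * al i x.

Definition game w (x : K -> int) : K -> int := word_act S game_op w x.

Lemma game_opK i x : game_op i (game_op i x) = x.
Proof. exact: reflop_inv al_diag i x (erefl _) (erefl _). Qed.

Let game_comm i j x : i != j -> ~~ adj i j ->
  game_op i (game_op j x) = game_op j (game_op i x).
Proof. exact: (reflop_comm adj_sym al_nadj). Qed.

Let game_braid i j x : i != j -> adj i j ->
  game_op i (game_op j (game_op i x)) = game_op j (game_op i (game_op j x)).
Proof. exact: (reflop_braid adj_sym (mulr1 1) al_diag al_adj). Qed.

Lemma game1 x : game 1%g x = x.
Proof. exact: word_act1. Qed.

Lemma game_gen_mul i w x : game (S i * w)%g x = game_op i (game w x).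
Proof.
have [dn_i|up_i] := boolP (descent S i w); last exact: word_act_up.
rewrite -{2}(gen_mulK S i w) [game (S i * (S i * w))%g x](word_act_up adj_sym) //.
  by rewrite game_opK.
by rewrite descent_mul dn_i.
Qed.

Lemma game_mul w w' x : game (w * w')%g x = game w (game w' x).
Proof.
elim/(weak_ind (S := S)): w => [|i w _ IHw]; first by rewrite mul1g game1.
by rewrite -mulgA !game_gen_mul IHw.
Qed.

Lemma game_word u x : game (word_val S u) x = foldr game_op x u.
Proof.
elim: u => [|i u IHu]; first by rewrite /word_val big_nil game1.
by rewrite word_val_cons game_gen_mul IHu.
Qed.

Variable x0 : K -> int.
Hypothesis x0_dominant : forall i, 0 < al i x0.

(** The orbit of a dominant point detects descents.  For a descent j of w
    adjacent to i, the value at w = s_j w' is the sum of the values of i and j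
    at w'; if i is a descent of w' = s_i w'', this sum is the value of j at w''. *)
Lemma game_pos w i : ~~ descent S i w -> 0 <= al i (game w x0).
Proof.
have [k] := ubnP (len S w); elim: k w i => // k IHk w i lt_w up_i.
have [->|ne_w1] := eqVneq w 1%g; first by rewrite game1 ltW.
have [j dn_j] := descent_exists S ne_w1.
have ne_ij : i != j by apply: contraNneq up_i => ->.
set w' := (S j * w)%g; have def_w : w = (S j * w')%g by rewrite gen_mulK.
have up_j : ~~ descent S j w' by rewrite descent_mul dn_j.
have lt_w' : (len S w' < k)%N by rewrite -ltnS -len_down.
clearbody w'; rewrite def_w game_gen_mul; have [adj_ij|nadj_ij] := boolP (adj i j); last first.
  rewrite al_nadj // mul1r IHk //; apply: contra up_i => dn_i.
  rewrite def_w /descent etaM eta_gen (inj_eq (gen_inj adj_sym (S := S))) (negPf ne_ij).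
  by rewrite conjgE gen_invg (comm_rel S ne_ij nadj_ij) gen_mulK.
rewrite al_adj // mul1r; have [dn_i'|up_i'] := boolP (descent S i w'); last first.
  by rewrite addr_ge0 ?IHk.
set w'' := (S i * w')%g; have def_w' : w' = (S i * w'')%g by rewrite gen_mulK.
have lt_w'' : (len S w'' < k)%N by apply: leq_trans lt_w'; rewrite (len_down dn_i') ltnW.
have ne_ji : j != i by rewrite eq_sym.
clearbody w''; rewrite def_w' !game_gen_mul al_diag al_adj 1?adj_sym // mulN1r mul1r addrCA addNr addr0.
apply: IHk => //; apply: contra up_i => dn_j''.
rewrite def_w def_w' /descent !etaM !eta_gen !(inj_eq (gen_inj adj_sym (S := S))) (negPf ne_ij).
have br := braid_rel S adj_ij.
have -> : ((S i ^ S j) == S i)%g = false.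
  have := up_gen2 adj_sym S ne_ij adj_ij.
  rewrite /descent etaM !eta_gen (inj_eq (gen_inj adj_sym (S := S))) (negPf ne_ij).
  by move/negPf.
have -> : ((S i ^ S j) ^ S i = S j)%g.
  rewrite !conjgE !gen_invg !mulgA br -(mulgA _ (S j) (S j)) gen_sq mulg1.
  by rewrite -mulgA gen_sq mulg1.
by [].
Qed.

Lemma game_gt0 w i : 0 < al i (game w x0) -> ~~ descent S i w.
Proof.
apply: contraTN => dn_i; rewrite -(gen_mulK S i w) game_gen_mul al_diag mulN1r.
by rewrite oppr_gt0 -leNgt game_pos // descent_mul dn_i.
Qed.

Lemma game_lt0 w i : al i (game w x0) < 0 -> descent S i w.
Proof. by move=> lt0; apply/negPn/negP=> /game_pos; rewrite leNgt lt0. Qed.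

Lemma game_faithful w w' : game w x0 = game w' x0 -> w = w'.
Proof.
move=> eq_ww'; suff: (w'^-1 * w = 1)%g by move/(canRL (mulKVg w'))=> ->; rewrite mulg1.
apply: (no_descent (S := S)) => i; apply: game_gt0.
by rewrite game_mul eq_ww' -game_mul mulVg game1.
Qed.

(** The legal sequences of moves of the numbers game, a move being legal at the
    nodes of positive value; from a dominant point they are the reduced words. *)
Fixpoint fires (x : K -> int) (u : seq I) : bool :=
  if u is i :: u' then (0 < al i (foldr game_op x u')) && fires x u' else true.

Lemma fires_cat x u u' : fires x (u ++ u') = fires (foldr game_op x u') u && fires x u'.
Proof. by elim: u => //= i u ->; rewrite foldr_cat andbA. Qed.

Lemma fires_reduced u : fires x0 u -> reduced S u.
Proof.
elim: u => [|i u IHu]; first by rewrite /reduced /word_val big_nil len1.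
rewrite /= => /andP[pos_i /IHu red_u]; rewrite reduced_cons red_u game_gt0 //.
by rewrite game_word.
Qed.
End NumbersGame.

(** * Signed permutations and the longest element of type D *)

Section SignedPermutations.
Variables (n : nat) (W : finGroupType).
Local Notation I := (Dnode n.+1).
Local Notation adj := (@Dadj n.+1).
Variable S : coxeterSystem (simply_laced adj) W.

Lemma Dadj_irr : irreflexive adj.
Proof. by case=> [b|k] //=; rewrite !gtn_eqF. Qed.

(** The coordinates are numbered from 0 to n.+2: the fork nodes correspond to
    the roots e_1 - e_0 and e_1 + e_0, the node k of the long branch to
    e_(k+2) - e_(k+1). *)
Definition wall (i : I) (h : nat -> int) : int :=
  match i with
  | inl true => h 1%N - h 0%N
  | inl false => h 0%N + h 1%N
  | inr k => h k.+2 - h k.+1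
  end.

Definition wall_root (i : I) (k : nat) : int :=
  match i with
  | inl true => (k == 1%N)%:R - (k == 0%N)%:R
  | inl false => (k == 0%N)%:R + (k == 1%N)%:R
  | inr l => (k == l.+2)%:R - (k == l.+1)%:R
  end.

Local Notation gop := (game_op wall wall_root).
Local Notation game := (game S wall wall_root).

Lemma wall_diag i x : wall i (gop i x) = - 1 * wall i x.
Proof.
by case: i => [[]|k]; rewrite /= /game_op !reflopE /= ?eqxx ?(gtn_eqF (ltnSn _)) ?(ltn_eqF (ltnSn _)) /=; ring.
Qed.

Let eqS (k : nat) : (k == k.+1) = false. Proof. lia. Qed.
Let eqS' (k : nat) : (k.+1 == k) = false. Proof. lia. Qed.
Let eqSS2 (k : nat) : (k == k.+2) = false. Proof. lia. Qed.
Let eqSS2' (k : nat) : (k.+2 == k) = false. Proof. lia. Qed.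

Let eq0S (k : nat) : (0 == k.+1)%N = false. Proof. by []. Qed.
Let eq1SS (k : nat) : (1 == k.+2)%N = false. Proof. by []. Qed.
Let eq1S (k : nat) : k != 0%N -> (1 == k.+1)%N = false. Proof. by case: k. Qed.

Let eqS0 (k : nat) : (k.+1 == 0)%N = false. Proof. by []. Qed.
Let eqSS1 (k : nat) : (k.+2 == 1)%N = false. Proof. by []. Qed.
Let eqS1 (k : nat) : k != 0%N -> (k.+1 == 1)%N = false. Proof. by case: k. Qed.

Lemma wall_adj i j x : i != j -> adj i j -> wall i (gop j x) = 1 * wall i x + wall j x.
Proof.
case: i => [b|k]; case: j => [c|l] //= ne_ij.
- by move/eqP=> l0; case: b ne_ij => _; rewrite /= /game_op !reflopE /= l0 /=; ring.
- by move/eqP=> k0; case: c ne_ij => _; rewrite k0 /= /game_op !reflopE /=; ring.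
case/orP=> /eqP kl; rewrite /game_op !reflopE /= -!kl !eqSS ?eqxx.
  by rewrite !eqS !eqSS2 /=; ring.
by rewrite !eqS' !eqSS2' /=; ring.
Qed.

Lemma wall_nadj i j x : i != j -> ~~ adj i j -> wall i (gop j x) = 1 * wall i x.
Proof.
case: i => [b|k]; case: j => [c|l] //= ne_ij.
- by move=> _; case: b ne_ij; case: c => //= _; rewrite /game_op !reflopE /=; ring.
- move=> ne_l0; case: b ne_ij => _; rewrite /game_op !reflopE /=.
    move: (nat_of_ord l) ne_l0 => m ne_m0; rewrite ?(eq0S, eq1SS, eq1S ne_m0) /=.
    by move: (x m.+2) (x m.+1) (x 0%N) (x 1%N) => a b' c' d; ring.
  move: (nat_of_ord l) ne_l0 => m ne_m0; rewrite ?(eq0S, eq1SS, eq1S ne_m0) /=.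
  by move: (x m.+2) (x m.+1) (x 0%N) (x 1%N) => a b' c' d; ring.
- move=> ne_k0; case: c ne_ij => _; rewrite /game_op !reflopE /=.
    move: (nat_of_ord k) ne_k0 => m ne_m0; rewrite ?(eqS0, eqSS1, eqS1 ne_m0) /=.
    by move: (x m.+2) (x m.+1) (x 0%N) (x 1%N) => a b' c' d; ring.
  move: (nat_of_ord k) ne_k0 => m ne_m0; rewrite ?(eqS0, eqSS1, eqS1 ne_m0) /=.
  by move: (x m.+2) (x m.+1) (x 0%N) (x 1%N) => a b' c' d; ring.
rewrite negb_or => /andP[/negPf kl /negPf lk].
have /negPf kl' : (k != l :> nat) by apply: contra ne_ij => /eqP/ord_inj->.
by rewrite /game_op !reflopE /= !eqSS kl' kl [nat_of_ord k == l.+1]eq_sym lk /=; ring.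
Qed.

Definition chain_node k : I := inr (inord k).
Local Notation nd := chain_node.

Lemma wall_nd k h : (k <= n)%N -> wall (nd k) h = h k.+2 - h k.+1.
Proof. by move=> le_kn; rewrite /= inordK. Qed.

Lemma gop_nd k h : (k <= n)%N -> gop (nd k) h =
  fun i => if i == k.+1 then h k.+2 else if i == k.+2 then h k.+1 else h i.
Proof.
move=> le_kn; apply/funext=> i; rewrite /game_op reflopE /= inordK //.
have [->|_] := eqVneq i k.+1; first by rewrite eqS /=; ring.
by have [->|_] := eqVneq i k.+2; rewrite /=; ring.
Qed.

Lemma gop_plus h : gop Oplus h =
  fun i => if i == 0%N then h 1%N else if i == 1%N then h 0%N else h i.
Proof. by apply/funext=> -[|[|i]]; rewrite /game_op reflopE /=; ring. Qed.

Lemma gop_minus h : gop Ominus h =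
  fun i => if i == 0%N then - h 1%N else if i == 1%N then - h 0%N else h i.
Proof. by apply/funext=> -[|[|i]]; rewrite /game_op reflopE /=; ring. Qed.

Definition cycle_down m (h : nat -> int) i :=
  if i == 1%N then h m.+1 else if (2 <= i <= m.+1)%N then h i.-1 else h i.
Definition cycle_up m (h : nat -> int) i :=
  if i == m.+1 then h 1%N else if (1 <= i <= m)%N then h i.+1 else h i.

(* Compares two entries of the vector h selected by nested conditionals. *)
Ltac split_ifs h :=
  repeat (case: ifP => ?); first [reflexivity | congr (h _); lia | congr (- h _); lia | exfalso; lia].

Lemma mkseq_ndS m : mkseq nd m.+1 = rcons (mkseq nd m) (nd m).
Proof. exact: mkseqS. Qed.

Lemma foldr_down m h : (m <= n.+1)%N -> foldr gop h (mkseq nd m) = cycle_down m h.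
Proof.
elim: m h => [|m IHm] h le_mn.
  by apply/funext=> i; rewrite /cycle_down /=; split_ifs h.
rewrite mkseq_ndS foldr_rcons IHm 1?ltnW // gop_nd //.
by apply/funext=> i; rewrite /cycle_down; split_ifs h.
Qed.

Lemma foldr_up m h : (m <= n.+1)%N -> foldr gop h (rev (mkseq nd m)) = cycle_up m h.
Proof.
elim: m h => [|m IHm] h le_mn.
  by apply/funext=> i; rewrite /cycle_up /=; split_ifs h.
rewrite mkseq_ndS rev_rcons /= IHm 1?ltnW // gop_nd //.
by apply/funext=> i; rewrite /cycle_up; split_ifs h.
Qed.

(** A word for the signed permutation that negates the coordinates 0 and m + 1:
    the letters carry the coordinate m + 1 down to 1, negate it together with
    the coordinate 0, and carry it back. *)
Definition flip_word m : seq I := rev (mkseq nd m) ++ [:: Ominus; Oplus] ++ mkseq nd m.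

Lemma foldr_flip_word m h : (m <= n.+1)%N ->
  foldr gop h (flip_word m) = fun i => if (i == 0%N) || (i == m.+1) then - h i else h i.
Proof.
move=> le_mn; rewrite !foldr_cat foldr_down // foldr_up //= gop_plus gop_minus.
by apply/funext=> i; rewrite /cycle_up /cycle_down /=; split_ifs h.
Qed.

Local Notation fires := (fires wall wall_root).

Lemma fires_down m h : (m <= n.+1)%N -> (forall l, (l < m)%N -> h l.+1 < h m.+1) ->
  fires h (mkseq nd m).
Proof.
elim: m h => [|m IHm] h le_mn // lt_h.
have pos : 0 < wall (nd m) h by rewrite wall_nd // subr_gt0 lt_h.
rewrite mkseq_ndS -cats1 fires_cat; apply/andP; split; last by apply/andP.
apply: IHm => [|l lt_lm]; first exact: ltnW.
rewrite /foldr gop_nd // eqxx eqSS (ltn_eqF lt_lm) eqSS (ltn_eqF (leqW lt_lm)).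
by rewrite lt_h // ltnW.
Qed.

Lemma fires_up m h : (m <= n.+1)%N -> (forall l, (l < m)%N -> h 1%N < h l.+2) ->
  fires h (rev (mkseq nd m)).
Proof.
elim: m => [|m IHm] le_mn // lt_h.
have pos : 0 < wall (nd m) (cycle_up m h).
  have lt_m : (m.+2 <= m)%N = false by lia.
  by rewrite wall_nd // subr_gt0 /cycle_up eqxx eqS' lt_m lt_h.
rewrite mkseq_ndS rev_rcons; apply/andP; split.
  by rewrite foldr_up // ltnW.
by apply: IHm => [|l lt_lm]; [apply: ltnW | rewrite lt_h // ltnW].
Qed.

Lemma fires_flip_word m h : (m <= n.+1)%N -> h 0%N = 0 ->
  (forall l, (l <= m)%N -> h l.+1 = l.+1%:R) -> fires h (flip_word m).
Proof.
move=> le_mn h0 hS.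
have d0 : cycle_down m h 0%N = 0 by rewrite /cycle_down.
have d1 : cycle_down m h 1%N = m.+1%:R by rewrite /cycle_down eqxx hS.
have mid : foldr gop (cycle_down m h) [:: Ominus; Oplus] =
    fun i => if i is 0%N then 0 else if i is 1%N then - m.+1%:R else cycle_down m h i.
  by apply/funext=> -[|[|i]]; rewrite /= gop_plus gop_minus /= ?d0 ?d1 ?oppr0.
rewrite /flip_word !fires_cat foldr_cat foldr_down // mid; apply/and3P; split.
- apply: fires_up => // l lt_lm; rewrite /cycle_down /= ltnS lt_lm hS ?(ltnW lt_lm) //.
  by apply: (@lt_trans _ _ 0); rewrite ?oppr_lt0 ltr0Sn.
- apply/and3P; split=> //; last by rewrite /= d0 d1 subr0 ltr0Sn.
  by rewrite /= gop_plus /= d0 d1 addr0 ltr0Sn.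
by apply: fires_down => // l lt_lm; rewrite !hS // ?ltr_nat // ltnW.
Qed.

(** Negating all coordinates one after the other; the coordinate 0 changes sign
    at each step, which is the source of the parity of n in the result. *)
Fixpoint longest_word m := if m is m'.+1 then longest_word m' ++ flip_word m else flip_word 0.

Lemma size_longest_word m : size (longest_word m) = (m.+1 * m.+2)%N.
Proof.
have size_flip_word k : size (flip_word k) = k.+1.*2.
  by rewrite /flip_word !size_cat size_rev size_mkseq /= -addnn; lia.
elim: m => [|m IHm]; first by [].
by rewrite [longest_word _]/= size_cat IHm size_flip_word -addnn; lia.
Qed.

Lemma fires_longest_word m h : (m <= n.+1)%N -> h 0%N = 0 ->
  (forall l, (l <= m)%N -> h l.+1 = l.+1%:R) -> fires h (longest_word m).
Proof.
elim: m h => [|m IHm] h le_mn h0 hS; first exact: fires_flip_word.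
rewrite /= fires_cat fires_flip_word // andbT foldr_flip_word //.
apply: IHm => [||l le_lm]; first exact: ltnW.
  by rewrite /= h0 oppr0.
by rewrite /= eqSS (ltn_eqF (_ : (l < m.+1)%N)) // hS // ltnW.
Qed.

Lemma foldr_longest_word m h : (m <= n.+1)%N -> foldr gop h (longest_word m) =
  fun i => if i == 0%N then (-1) ^+ m.+1 * h 0%N else if (i <= m.+1)%N then - h i else h i.
Proof.
elim: m h => [|m IHm] h le_mn.
  rewrite foldr_flip_word //; apply/funext=> -[|[|i]] //=.
  by rewrite expr1 mulN1r.
rewrite /= foldr_cat foldr_flip_word // IHm 1?ltnW //; apply/funext=> i /=.
have [_|i_gt0] := posnP i; first by rewrite [in RHS]exprSr mulrN1 mulrN mulNr.
by split_ifs h.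
Qed.

(** A dominant vector; its coordinate 0 vanishes, so that all walls are on the
    negative side of its image under w0 whatever the parity of n. *)
Definition height (i : nat) : int := i%:R.

Lemma height_dominant i : 0 < wall i height.
Proof. by case: i => [[]|k] /=; rewrite /height; lia. Qed.

Lemma longest_word_reduced : reduced S (longest_word n.+1).
Proof.
apply: (fires_reduced (@Dadj_sym n.+1) S wall_diag wall_adj wall_nadj height_dominant).
exact: fires_longest_word.
Qed.

Lemma game_longest_word h : game (word_val S (longest_word n.+1)) h = foldr gop h (longest_word n.+1).
Proof. exact: (game_word (@Dadj_sym n.+1) S wall_diag wall_adj wall_nadj). Qed.

Lemma word_val_longest_word : word_val S (longest_word n.+1) = longest S.
Proof.
apply: all_descents => i.
apply: (game_lt0 (@Dadj_sym n.+1) wall_diag wall_adj wall_nadj height_dominant).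
rewrite game_longest_word foldr_longest_word //; set f := (fun i => _).
have f0 : f 0%N = 0 by rewrite /f /= mulr0.
have fS k : (k <= n.+1)%N -> f k.+1 = - k.+1%:R by rewrite /f /= ltnS => ->.
clearbody f; case: i => [[]|k]; rewrite /wall ?f0 !fS //; first by lia.
by have := ltn_ord k; lia.
Qed.

Lemma len_longestD : len S (longest S) = (n.+2 * n.+3)%N.
Proof. by rewrite -word_val_longest_word (reduced_len longest_word_reduced) size_longest_word. Qed.

(** Both sides act in the same way on the dominant vector, and the coordinate 0
    is negated by w0 exactly when hat is the identity. *)
Lemma longest_hat i : (longest S * S i = S (hat i) * longest S)%g.
Proof.
apply: (game_faithful (S := S) (@Dadj_sym n.+1) wall_diag wall_adj wall_nadj height_dominant).
have gM := game_mul (@Dadj_sym n.+1) S wall_diag wall_adj wall_nadj.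
have gS := game_gen_mul (@Dadj_sym n.+1) S wall_diag wall_adj wall_nadj.
have gSi : game (S i) height = gop i height.
  rewrite -{1}[S i]mulg1 gS.
  by rewrite (game1 (@Dadj_sym n.+1) S wall_diag wall_adj wall_nadj).
rewrite gS gM gSi -word_val_longest_word !game_longest_word !foldr_longest_word //.
case: i {gSi} => [b|k].
  have gb c h : gop (inl c) h = gop (if c then Oplus else Ominus) h by case: c.
  rewrite [hat _]/= !gb -signr_odd /= !negbK; apply/funext=> i.
  case: b; case: (odd n); rewrite /= ?gop_plus ?gop_minus /=;
    by case: i => [|[|i]] //=; rewrite /height ?mulr0 ?mul1r ?mulN1r ?oppr0 ?opprK.
have k_nd : inr k = nd k by rewrite /nd inord_val.
have le_kn : (k <= n)%N by rewrite -ltnS.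
rewrite [hat _]/= k_nd !gop_nd //; apply/funext=> -[|i] //=.
by split_ifs height.
Qed.
End SignedPermutations.

(** * The longest element in the reflection representation *)

Lemma q_neq0 : v + vV != 0.
Proof.
apply/eqP=> q0; have : laurent_poly ('X * 'X + 1) = laurent_poly 0.
  rewrite laurent_polyD laurent_polyM laurent_polyX -polyC1 laurent_polyC.
  by rewrite -[1%:~R]/1 -v_vV -mulrDr q0 mulr0 /laurent_poly rmorph0 horner0.
move/laurent_poly_inj/(congr1 (fun p : {poly int} => p`_0)).
by rewrite coefD coefXM coef1 coef0.
Qed.

Section LongestAction.
Variables (n : nat) (W : finGroupType).
Local Notation I := (Dnode n.+1).
Local Notation adj := (@Dadj n.+1).
Variable S : coxeterSystem (simply_laced adj) W.
Local Notation L := laurent.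
Local Notation q := (v + vV).
Local Notation w0 := (longest S).
Local Notation Qop := (refl_op adj).
Local Notation Qact := (refl_act S).
Local Notation cartan_row := (cartan_pairing adj).

Let adj_sym : symmetric adj := @Dadj_sym n.+1.
Let adj_irr : irreflexive adj := @Dadj_irr n.

Lemma refl_act_lin w a b x y : Qact w (fun k => a * x k - b * y k) =
  fun k => a * Qact w x k - b * Qact w y k.
Proof.
elim/(weak_ind (S := S)): w => [|i w up_i IHw]; first by rewrite !refl_act1.
rewrite !refl_act_up // IHw; apply/funext=> k; rewrite /Qop !reflopE.
have -> : cartan_row i (fun k => a * Qact w x k - b * Qact w y k) =
    a * cartan_row i (Qact w x) - b * cartan_row i (Qact w y).
  by rewrite /cartan_pairing sumrB -!mulr_sumr; ring.
by ring.
Qed.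

Lemma refl_act_longest i x : Qact w0 (Qop i x) = Qop (hat i) (Qact w0 x).
Proof.
have dn_w0 t : descent S t w0 by apply: eta_longest; apply: gen_refl.
have dn_hat := dn_w0 (hat i).
have up_hat : ~~ descent S (hat i) (S (hat i) * w0) by rewrite descent_mul dn_hat.
have eq_w0 : w0 = (S (hat i) * w0 * S i)%g.
  by rewrite -longest_hat -mulgA gen_sq mulg1.
have len_si : len S (S i) = 1%N by rewrite -[S i]mulg1 len_up ?descent1 // len1.
have Q_si : Qact (S i) x = Qop i x by rewrite -[S i]mulg1 refl_act_up ?descent1 // refl_act1.
rewrite -{1}(gen_mulK S (hat i) w0) refl_act_up //; congr (Qop _ _).
have len_u : len S (S (hat i) * w0 * S i)%g = (len S (S (hat i) * w0)%g + len S (S i))%N.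
  by rewrite -eq_w0 (len_down dn_hat) len_si addn1.
by rewrite {2}eq_w0 [RHS]refl_act_mul // Q_si.
Qed.

(** Schur's lemma, by hand: w0 maps the unit vector of i to a multiple of that of
    hat i, and the factor is the same for adjacent nodes. *)
Definition diag_coef i : L := Qact w0 (unit_vec i) (hat i).

Lemma cartan_unit i k : cartan_row i (unit_vec k) = q * (i == k)%:R - (adj i k)%:R.
Proof. by rewrite /cartan_pairing sum_unit_vec. Qed.

Lemma cartan_row_ext i x y : x =1 y -> cartan_row i x = cartan_row i y.
Proof. by move=> eq_xy; congr (cartan_row i _); apply/funext. Qed.

(** The rank one parts of the identity Q_w0 Q_i = Q_(hat i) Q_w0. *)
Lemma refl_act_root i x k : cartan_row i x * Qact w0 (unit_vec i) k =
  cartan_row (hat i) (Qact w0 x) * unit_vec (hat i) k.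
Proof.
have := congr1 (fun f => f k) (refl_act_longest i x).
rewrite /refl_op [X in Qact _ X](_ : _ = fun l => v * x l - cartan_row i x * unit_vec i l) //.
by rewrite refl_act_lin reflopE => /addrI/oppr_inj.
Qed.

Lemma refl_act_unit i k : Qact w0 (unit_vec i) k = diag_coef i * unit_vec (hat i) k.
Proof.
rewrite /diag_coef [unit_vec (hat i) k]/unit_vec; have [->|ne_k] := eqVneq k (hat i); first by rewrite mulr1.
have := refl_act_root i (unit_vec i) k.
rewrite cartan_unit eqxx adj_irr mulr1 subr0 /unit_vec (negPf ne_k) mulr0.
by rewrite mulr0 -[RHS](mulr0 q) => /(laurent_mulI q_neq0).
Qed.

Lemma Dadj_hat i k : adj (hat i) (hat k) = adj i k.
Proof. by case: i; case: k. Qed.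

Lemma diag_coef_adj i k : adj i k -> diag_coef i = diag_coef k.
Proof.
move=> adj_ik; have := refl_act_root i (unit_vec k) (hat i).
have ne_ik : (i == k) = false by apply: contraTF adj_ik => /eqP->; rewrite adj_irr.
have hatK : involutive (@hat n.+1) by case=> [b|l] //=; case: (odd _); rewrite ?negbK.
have ne_hat : (hat i == hat k) = false by rewrite (inj_eq (inv_inj hatK)).
rewrite cartan_unit ne_ik adj_ik mulr0 sub0r mulN1r -/(diag_coef i).
rewrite (cartan_row_ext _ (refl_act_unit k)).
have -> : cartan_row (hat i) (fun l => diag_coef k * unit_vec (hat k) l) =
    diag_coef k * cartan_row (hat i) (unit_vec (hat k)).
  by rewrite /cartan_pairing -mulr_sumr; ring.
rewrite cartan_unit ne_hat Dadj_hat adj_ik mulr0 sub0r /unit_vec eqxx mulr1 mulrN1.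
exact: oppr_inj.
Qed.

Local Notation nd := (@chain_node n).

Lemma adj_nd k l : (k <= n)%N -> (l <= n)%N -> adj (nd k) (nd l) = (k.+1 == l) || (l.+1 == k).
Proof. by move=> le_k le_l; rewrite /= !inordK. Qed.

Lemma adj_inl_nd b k : (k <= n)%N -> adj (inl b) (nd k) = (k == 0%N).
Proof. by move=> le_k; rewrite /= !inordK. Qed.

Lemma diag_coef_nd k : (k <= n)%N -> diag_coef (nd k) = diag_coef (nd n).
Proof.
move=> le_kn; rewrite -(subKn le_kn); elim: (n - k)%N => [|d IHd]; first by rewrite subn0.
have [lt_dn|le_nd] := ltnP d n; last first.
  by rewrite -IHd (_ : (n - d.+1 = n - d)%N) //; lia.
by rewrite -IHd; apply: diag_coef_adj; rewrite adj_nd ?leq_subr // subnSK ?eqxx.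
Qed.

Lemma diag_coef_const i : diag_coef i = diag_coef (nd n).
Proof.
case: i => [b|k]; last first.
  have le_kn : (k <= n)%N by rewrite -ltnS.
  by rewrite -(diag_coef_nd le_kn) /chain_node inord_val.
rewrite -(diag_coef_nd (leq0n n)); apply: diag_coef_adj.
by rewrite adj_inl_nd.
Qed.

Lemma sum_adj_inl b (x : I -> L) : \sum_(k | adj (inl b) k) x k = x (nd 0).
Proof.
rewrite (bigD1 (nd 0)) ?adj_inl_nd //= big1 ?addr0 // => -[c|l] //= /andP[/eqP l0].
by rewrite /chain_node (_ : l = inord 0) ?eqxx //; apply/val_inj; rewrite /= inordK.
Qed.

(** The sum over the neighbours of the node k on the side of the fork. *)
Definition lower_sum k (x : I -> L) : L :=
  if k is k'.+1 then x (nd k') else x Oplus + x Ominus.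

Lemma sum_adj_nd k (x : I -> L) : (k <= n)%N ->
  \sum_(l | adj (nd k) l) x l = lower_sum k x + (if (k < n)%N then x (nd k.+1) else 0).
Proof.
move=> le_kn.
have eq_nd l m : (m <= n)%N -> (inr l == nd m :> I) = (l == m :> nat).
  move=> le_m; apply/eqP/eqP=> [[->]|lm]; first by rewrite inordK.
  by rewrite /chain_node -lm inord_val.
pose below (l : I) := if l is inr l' then (l' < k)%N else true.
rewrite (bigID below) {}/below /=; congr (_ + _).
  case: k le_kn => [|k] le_kn /=.
    rewrite (bigD1 Oplus) /= ?inordK // (bigD1 Ominus) /= ?inordK // big1 ?addr0 //.
    by case=> [[]|l] //=; rewrite ltn0 !andbF.
  rewrite (bigD1 (nd k)) /= ?inordK ?ltnSn ?eqxx ?orbT // 1?ltnW //.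
  rewrite big1 ?addr0 // => -[c|l] //=; rewrite (eq_nd _ _ (ltnW le_kn)).
  by move=> /andP[/andP[/orP[/eqP|/eqP] lk lt_l] ne_l]; exfalso; lia.
rewrite inordK //; case: ltnP => [lt_kn|le_nk].
  rewrite (bigD1 (nd k.+1)) /= ?inordK ?eqxx //= ?ltnNge ?leqnSn //.
  rewrite big1 ?addr0 // => -[c|l] //=; first by rewrite andbF.
  by rewrite eq_nd // => /andP[/andP[/orP[/eqP|/eqP] lk lt_l] ne_l]; exfalso; lia.
rewrite big1 // => -[c|l] /=; first by rewrite andbF.
by move=> /andP[/orP[/eqP|/eqP] lk lt_l]; exfalso; have := ltn_ord l; lia.
Qed.
End LongestAction.

(** * The scalar of the longest element, and the linear system *)

Section LongestScalar.
Variables (n : nat) (W : finGroupType).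
Local Notation I := (Dnode n.+1).
Local Notation adj := (@Dadj n.+1).
Variable S : coxeterSystem (simply_laced adj) W.
Local Notation L := laurent.
Local Notation q := (v + vV).
Local Notation w0 := (longest S).
Local Notation Qop := (refl_op adj).
Local Notation Qact := (refl_act S).
Local Notation nd := (@chain_node n).
Local Notation lower := (@lower_sum n).

Lemma refl_op_ne i k x : k != i -> Qop i x k = v * x k.
Proof. by move=> /negPf ne; rewrite /refl_op reflopE /unit_vec ne mulr0 subr0. Qed.

Lemma refl_op_nd k x : (k <= n)%N -> Qop (nd k) x (nd k) =
  lower k x + (if (k < n)%N then x (nd k.+1) else 0) - vV * x (nd k).
Proof.
by move=> le_kn; rewrite /refl_op reflopE /unit_vec eqxx mulr1 /cartan_pairing sum_adj_nd //;
  move: (lower k x) (if _ then _ else _) (x (nd k)) => a b c; ring.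
Qed.

Lemma refl_op_inl b x : Qop (inl b) x (inl b) = x (nd 0) - vV * x (inl b).
Proof. by rewrite /refl_op reflopE /unit_vec eqxx mulr1 /cartan_pairing sum_adj_inl; ring. Qed.

Lemma nd_neq k l : (k <= n)%N -> (l <= n)%N -> (nd k != nd l) = (k != l).
Proof.
move=> le_k le_l; congr (~~ _); apply/eqP/eqP=> [[]|->//].
by move/(congr1 val); rewrite /= !inordK.
Qed.

Lemma lower_Qop k x : (k <= n)%N -> lower k (Qop (nd k) x) = v * lower k x.
Proof.
case: k => [|k] le_kn; first by rewrite /= !refl_op_ne // mulrDr.
by rewrite /= refl_op_ne // (nd_neq (ltnW le_kn)) // ltn_eqF.
Qed.

(** The forms lower k - v^-1 x_k, and v x_k - lower k in [foldr_refl_op_down],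
    deform the weights of the vector representation: the reflections of the
    branch carry each of them to the next one. *)
Lemma foldr_refl_op_up k y : (k <= n)%N ->
  let z := foldr Qop y (rev (mkseq nd k)) in
  lower k z - vV * z (nd k) = lower 0 y - vV * y (nd 0).
Proof.
elim: k => [//|k IHk] lt_kn; have le_kn := ltnW lt_kn.
rewrite mkseq_ndS rev_rcons -(IHk le_kn) /=; set z := foldr _ _ _.
rewrite refl_op_nd // lt_kn refl_op_ne ?nd_neq //; last by rewrite gtn_eqF.
by rewrite [vV * (v * _)]mulrA [vV * v]mulrC v_vV mul1r; ring.
Qed.

Lemma foldr_refl_op_down k y : (k <= n)%N ->
  let z := foldr Qop y [seq nd l | l <- iota k (n.+1 - k)] in
  v * z (nd k) - lower k z = - y (nd n).
Proof.
move=> le_kn; rewrite -(subKn le_kn); move: (n - k)%N (leq_subr k n) => d le_dn.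
rewrite subSn ?leq_subr // subKn //; elim: d le_dn => [|d IHd] le_dn /=.
  rewrite subn0 lower_Qop // refl_op_nd // ltnn.
  by rewrite addr0 mulrBr mulrA v_vV mul1r; ring.
rewrite lower_Qop ?leq_subr // refl_op_nd ?leq_subr // ltn_subrL (leq_trans _ le_dn) //.
rewrite subnSK //= -(IHd (ltnW le_dn)) /= mulrBr mulrDr mulrA v_vV mul1r.
have -> : (n - d = (n - d.+1).+1)%N by lia.
by rewrite /=; ring.
Qed.

Lemma foldr_refl_op_flip_word y : foldr Qop y (rev (flip_word n n.+1)) (nd n) = - y (nd n).
Proof.
rewrite /flip_word !rev_cat revK -catA !foldr_cat; set z := foldr Qop y _.
have down : v * z (nd 0) - lower 0 z = - y (nd n) by apply: (@foldr_refl_op_down 0).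
rewrite mkseq_ndS rev_rcons /= refl_op_nd // ltnn addr0 (foldr_refl_op_up _ (leqnn n)) -down /=.
rewrite (refl_op_inl true) [Qop Oplus _ Ominus]refl_op_ne // (refl_op_inl false) !refl_op_ne //.
rewrite -![inl _]/(Oplus) -![inl _]/(Ominus).
move: (z (nd 0)) (z Oplus) (z Ominus) => a b c; have vvV := v_vV.
by ring: vvV.
Qed.

Lemma foldr_refl_op_below u y : all (fun i => nd n != i) u ->
  foldr Qop y u (nd n) = v ^+ size u * y (nd n).
Proof.
elim: u => [|i u IHu] /=; first by rewrite mul1r.
by move=> /andP[ne_i /IHu IH]; rewrite refl_op_ne // IH exprS mulrA.
Qed.

Lemma longest_word_below m : (m <= n)%N -> all (fun i => nd n != i) (longest_word n m).
Proof.
have flip_word_below k : (k <= n)%N -> all (fun i => nd n != i) (flip_word n k).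
  move=> le_kn; suff mk : all (fun i => nd n != i) (mkseq nd k).
    by rewrite /flip_word !all_cat all_rev mk.
  by rewrite all_map; apply/allP=> l; rewrite mem_iota /= => lt_l; rewrite nd_neq //; lia.
elim: m => [|m IHm] le_mn /=; first by [].
by rewrite all_cat IHm 1?ltnW // flip_word_below.
Qed.

(** The word is reversed so that the letters of the last flip act last: they
    multiply the coordinate of the end node by -1, the other letters by v. *)
Lemma refl_act_longest_top x : Qact w0 x (nd n) = - v ^+ (n.+1 * n.+2) * x (nd n).
Proof.
have w0E : w0 = word_val S (rev (longest_word n n.+1)).
  by rewrite word_val_rev word_val_longest_word longestV.
rewrite w0E refl_act_reduced //; first last.
- rewrite /reduced -w0E len_longestD size_rev size_longest_word; exact: eqxx.
- exact: Dadj_irr.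
- exact: Dadj_sym.
rewrite [longest_word _ _]/= rev_cat foldr_cat foldr_refl_op_flip_word foldr_refl_op_below.
  by rewrite size_rev size_longest_word mulNr.
by rewrite all_rev longest_word_below.
Qed.

Lemma refl_act_longest_unit i k :
  Qact w0 (unit_vec i) k = - v ^+ (n.+1 * n.+2) * unit_vec (hat i) k.
Proof.
by rewrite refl_act_unit diag_coef_const /diag_coef refl_act_longest_top /unit_vec eqxx mulr1.
Qed.

Definition geo m : L := \sum_(t < m) v ^+ t.*2.

Lemma geoS m : geo m.+1 = geo m + v ^+ m.*2.
Proof. by rewrite /geo big_ord_recr. Qed.

Lemma geo_shift m : geo m.+1 = 1 + v ^+ 2 * geo m.
Proof.
rewrite /geo big_ord_recl expr0 mulr_sumr; congr (_ + _).
by apply: eq_bigr => t _; rewrite -exprD.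
Qed.

Lemma vpow1_neq0 m : v ^+ m.+1 + 1 != 0.
Proof.
apply/eqP=> e; have : laurent_poly ('X^(m.+1) + 1) = laurent_poly 0.
  rewrite laurent_polyD laurent_polyXn -polyC1 laurent_polyC.
  by rewrite -[1%:~R]/1 e /laurent_poly rmorph0 horner0.
move/laurent_poly_inj/(congr1 (fun p : {poly int} => p`_0)).
by rewrite coefD coefXn coef1 coef0.
Qed.

Lemma v_exp_neq0 k : v ^+ k != 0.
Proof.
by apply/eqP=> vk; have := vV_v_exp k; rewrite vk mulr0 => /esym/eqP; rewrite oner_eq0.
Qed.

Section Solve.
Variables (x : I -> L) (s s' : bool) (k : nat).
Hypothesis x_inl : forall b, q * x (inl b) - x (nd 0) =
  v ^+ (k + (2 * n + 4)) * (s == b)%:R + v ^+ k * (s' == b)%:R.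
Hypothesis x_nd : forall m, (m <= n)%N ->
  q * x (nd m) - (lower m x + (if (m < n)%N then x (nd m.+1) else 0)) = 0.

Let vvV := v_vV.

(** From the end of the branch, the unknowns are proportional to the quantum
    integers, here multiplied by a power of v to become polynomials. *)
Lemma solve_chain d : (d <= n)%N ->
  v ^+ d * x (nd (n - d)) = geo d.+1 * x (nd n) /\
  v ^+ d.+1 * lower (n - d) x = geo d.+2 * x (nd n).
Proof.
elim: d => [|d IHd] le_dn.
  have := x_nd (leqnn n); rewrite ltnn addr0 subn0 => /eqP; rewrite subr_eq0 => /eqP <-.
  rewrite !geoS /geo big_ord0 expr0 expr1 mul1r; split; first by ring.
  by rewrite mulrA; congr (_ * _); rewrite expr2; ring: vvV.
have [xd ld] := IHd (ltnW le_dn); have le_nd := leq_subr d.+1 n.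
have def_nd : (n - d = (n - d.+1).+1)%N by lia.
have xd' : v ^+ d.+1 * x (nd (n - d.+1)) = geo d.+2 * x (nd n).
  by rewrite -ld def_nd.
split=> //; have := x_nd le_nd.
rewrite (_ : (n - d.+1 < n)%N = true) ?def_nd //; last by lia.
rewrite -def_nd => /eqP; rewrite subr_eq0 => /eqP eq_l.
have -> : lower (n - d.+1) x = q * x (nd (n - d.+1)) - x (nd (n - d)) by rewrite eq_l; ring.
have -> : v ^+ d.+2 * (q * x (nd (n - d.+1)) - x (nd (n - d))) =
   (v ^+ 2 + 1) * (v ^+ d.+1 * x (nd (n - d.+1))) - v ^+ 2 * (v ^+ d * x (nd (n - d))).
  move: (x _) (x _) => a b; rewrite !exprS expr0; move: (v ^+ d) => p; ring: vvV.
rewrite xd' xd (geoS d.+2) [v ^+ d.+2.*2](_ : _ = v ^+ 2 * v ^+ d.+1.*2); last by rewrite -exprD.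
by rewrite (geoS d.+1); move: (geo _) (v ^+ _.*2) (x _) => g p y; ring.
Qed.

(** The sum of the two equations at the fork nodes determines the scale. *)
Lemma solve_top : x (nd n) = v ^+ (k + n.+2).
Proof.
have [x0 l0] := solve_chain (leqnn n); rewrite subnn in x0 l0.
apply: (@laurent_mulI (v ^+ (2 * n + 4) + 1)); first by rewrite addnS vpow1_neq0.
have sum_eq : q * lower 0 x - (x (nd 0) + x (nd 0)) = v ^+ k * (v ^+ (2 * n + 4) + 1).
  have -> : q * lower 0 x - (x (nd 0) + x (nd 0)) =
      (q * x (inl true) - x (nd 0)) + (q * x (inl false) - x (nd 0)).
    by rewrite /=; ring.
  by rewrite !x_inl exprD; case: s; case: s' => /=; move: (v ^+ k) (v ^+ _) => p r; ring.
have mul_eq : v ^+ n.+2 * (q * lower 0 x - (x (nd 0) + x (nd 0))) =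
    (v ^+ 2 + 1) * (v ^+ n.+1 * lower 0 x) - v ^+ 2 * (v ^+ n * x (nd 0) + v ^+ n * x (nd 0)).
  rewrite !exprS expr0; move: (v ^+ n) (lower 0 x) (x (nd 0)) => p a b; ring: vvV.
rewrite sum_eq x0 l0 in mul_eq.
have geo3 := geo_shift n.+2; rewrite geoS in geo3.
have geo2 := geo_shift n.+1.
have P2 : v ^+ n.+2.*2 = v ^+ (2 * n + 4) by congr (_ ^+ _); lia.
rewrite P2 in geo3.
have -> : (v ^+ (2 * n + 4) + 1) * x (nd n) =
    (v ^+ 2 + 1) * (geo n.+2 * x (nd n)) - v ^+ 2 * (geo n.+1 * x (nd n) + geo n.+1 * x (nd n)).
  have -> : v ^+ (2 * n + 4) = 1 + v ^+ 2 * geo n.+2 - geo n.+2 by rewrite -geo3; ring.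
  by rewrite geo2; move: (geo n.+1) (v ^+ 2) (x _) => g p y; ring.
by rewrite -mul_eq [v ^+ (k + _)]exprD; move: (v ^+ k) (v ^+ n.+2) (v ^+ _) => p r t; ring.
Qed.

Lemma solve_nd0 : x (nd 0) = v ^+ k.+2 * geo n.+1.
Proof.
have [x0 _] := solve_chain (leqnn n); rewrite subnn solve_top in x0.
apply: (laurent_mulI (v_exp_neq0 n)).
by rewrite x0 !addnS !exprS exprD; move: (v ^+ k) (v ^+ n) (geo _) => p r g; ring.
Qed.

Lemma solve_inl b : q * x (inl b) =
  v ^+ k * (v ^+ 2 * geo n.+1 + v ^+ (2 * n + 4) * (s == b)%:R + (s' == b)%:R).
Proof.
have /eqP := x_inl b; rewrite subr_eq => /eqP->; rewrite solve_nd0 exprD !exprS expr0.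
by move: (v ^+ k) (v ^+ _) (geo _) => p r g; ring.
Qed.
End Solve.

Lemma vsumS l a t : vsum l a (a + 4 * t.+1) = vsum l a (a + 4 * t) + v ^+ (l - (a + 4 * t.+1)).
Proof.
rewrite /vsum (@big_cat_nat _ _ _ (a + 4 * t).+1) /=; try lia.
congr (_ + _); rewrite big_mkcond.
have -> : ((a + 4 * t.+1).+1 = (a + 4 * t).+4.+1)%N by lia.
do 4 (rewrite big_ltn; last by lia); rewrite big_geq //.
have m1 : ((a + 4 * t).+1 == a %[mod 4])%N = false by lia.
have m2 : ((a + 4 * t).+2 == a %[mod 4])%N = false by lia.
have m3 : ((a + 4 * t).+3 == a %[mod 4])%N = false by lia.
have m4 : ((a + 4 * t).+4 == a %[mod 4])%N by lia.
rewrite m1 m2 m3 m4 /= !add0r addr0; congr (v ^+ _); lia.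
Qed.

Lemma vsum0 l a : vsum l a a = v ^+ (l - a).
Proof. by rewrite /vsum big_mkcond big_nat1 eqxx. Qed.

Lemma q_vsum r a t : q * vsum (a + 4 * t + r).+1 a (a + 4 * t) = v ^+ r * geo (2 * t + 2).
Proof.
elim: t r => [|t IHt] r.
  rewrite !muln0 !addn0 add0n vsum0 !geoS /geo big_ord0 -addnS addKn.
  rewrite exprS /= !exprS !expr0; move: (v ^+ r) => p; have vvV := v_vV; ring: vvV.
have -> : ((a + 4 * t.+1 + r).+1 = (a + 4 * t + (r + 4)).+1)%N by lia.
rewrite vsumS mulrDr IHt.
have -> : ((a + 4 * t + (r + 4)).+1 - (a + 4 * t.+1) = r.+1)%N by lia.
have -> : (2 * t.+1 + 2 = (2 * t + 2).+2)%N by lia.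
rewrite !geo_shift exprD [v ^+ r.+1]exprS !exprS !expr0.
by move: (v ^+ r) (geo _) => p g; have vvV := v_vV; ring: vvV.
Qed.
End LongestScalar.

(** * Paths to the fork nodes *)

Section ForkRoot.
Variables (n : nat) (W : finGroupType).
Local Notation I := (Dnode n.+1).
Local Notation adj := (@Dadj n.+1).
Variable S : coxeterSystem (simply_laced adj) W.
Local Notation nd := (@chain_node n).

Section Root.
Variable s : bool.

Definition fork_par (i : I) : I :=
  match i with
  | inl _ => nd 0
  | inr k => if (k : nat) is k'.+1 then nd k' else inl s
  end.

Definition fork_dep (i : I) : nat :=
  match i with inl t => if t == s then 0 else 2 | inr k => k.+1 end.

Fixpoint chain_word k : seq I := nd k :: (if k is k'.+1 then chain_word k' else [:: inl s]).

Definition fork_word (i : I) : seq I :=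
  match i with
  | inl t => if t == s then [:: inl s] else inl t :: chain_word 0
  | inr k => chain_word k
  end.

Definition fork_elt i : W := word_val S (fork_word i).

Lemma fork_adj_par i : i != inl s -> adj i (fork_par i).
Proof.
case: i => [t|k] _; first by rewrite adj_inl_nd.
rewrite /fork_par; case: k => [[|k] lt_k] //=.
by rewrite inordK ?eqxx ?orbT // ltnW.
Qed.

Lemma fork_dep_par i : i != inl s -> fork_dep i = (fork_dep (fork_par i)).+1.
Proof.
case: i => [t|[[|k] lt_k]] ne_i /=; rewrite ?eqxx //.
  have /negPf-> : t != s by apply: contraNneq ne_i => ->.
  by rewrite inordK.
by rewrite inordK // ltnW.
Qed.

Lemma fork_tree i k : adj i k ->
  (i != inl s /\ k = fork_par i) \/ (k != inl s /\ i = fork_par k).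
Proof.
have inr_nd (l : 'I_n.+1) m : (l : nat) = m -> inr l = nd m.
  by move=> <-; rewrite /chain_node inord_val.
have chain (a b : 'I_n.+1) : a.+1 = b -> inr a = fork_par (inr b).
  by rewrite /fork_par => <-; apply: inr_nd.
have fork b (l : 'I_n.+1) : l = 0%N :> nat ->
    ((inl b : I) != inl s /\ inr l = fork_par (inl b)) \/
    ((inr l : I) != inl s /\ inl b = fork_par (inr l)).
  move=> l0; have [->|ne_bs] := eqVneq b s; last first.
    by left; split; [apply: contraNneq ne_bs => -[->] | apply: inr_nd].
  by right; split=> //; rewrite /fork_par l0.
case: i => [b|i]; case: k => [c|k] //=.
- by move/eqP; apply: fork.
- by move/eqP/(fork c); case; [right | left].
by case/orP=> /eqP /chain; [right | left].
Qed.

Lemma fork_elt_root : fork_elt (inl s) = S (inl s).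
Proof. by rewrite /fork_elt /= eqxx word_val_cons /word_val big_nil mulg1. Qed.

Lemma fork_elt_par i : i != inl s -> fork_elt i = (S i * fork_elt (fork_par i))%g.
Proof.
case: i => [t|k] ne_i.
  have /negPf ne_ts : t != s by apply: contraNneq ne_i => ->.
  by rewrite /fork_elt /= ne_ts inordK // word_val_cons.
have def_k : inr k = nd k by rewrite /chain_node inord_val.
rewrite /fork_elt /fork_word def_k -{1}def_k /fork_par -def_k.
case: k {ne_i} def_k => [[|k] lt_k] def_k /=; rewrite ?eqxx word_val_cons -?def_k //.
by rewrite inordK // ltnW.
Qed.
End Root.

Lemma shortest_fork (hn : (0 < n.+1)%N) t s :
  shortest (Dadj_connected hn (inl t) (inl s)) = fork_word s (inl t).
Proof.
have [] := shortestP (Dadj_connected hn (inl t) (inl s)).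
set u := shortest _; move=> path_u min_u.
have path_fork : path_between (inl t) (inl s) (fork_word s (inl t)).
  rewrite /fork_word; case: (eqVneq t s) => [->|_]; first by rewrite /= !eqxx.
  by rewrite /= inordK // !eqxx.
have := min_u _ path_fork; move: path_u; rewrite /fork_word.
clear min_u path_fork; case: u => [//|x u] /= /and3P[/eqP-> path_u last_u].
case: (eqVneq t s) last_u => [->|ne_ts] last_u; first by case: u {path_u last_u}.
case: u path_u last_u => [|a [|b [|//]]] /=.
- by move=> _ /eqP[ts]; rewrite ts eqxx in ne_ts.
- by case: a => // k _ /eqP.
case: a => // k /andP[/eqP k0 _] /eqP-> _.
by congr [:: _; _; _]; congr inr; apply: val_inj; rewrite /= inordK.
Qed.
End ForkRoot.

(** * The Kazhdan-Lusztig polynomials *)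

Section Main.
Variables (n : nat) (hn : (2 <= n.+1)%N) (W : finGroupType).
Variable S : coxeterSystem (simply_laced (@Dadj n.+1)) W.
Variables (HH : algType laurent) (H : Dnode n.+1 -> HH).
Hypothesis hHH : is_hecke_algebra (simply_laced (@Dadj n.+1)) H.
Variable bar : {rmorphism HH -> HH}.
Hypothesis hbar : is_bar_involution H bar.
Variable p : W -> W -> laurent.
Hypothesis hp : is_KL_family S H bar p.
Local Notation w0 := (longest S).

Lemma KL_fork t s : p 1%g (s_ (ltnW hn) S (inl t) (inl s) * w0)%g = pen_coef S (inl s) w0 (inl t).
Proof.
rewrite /s_ shortest_fork -[(\prod_(k <- _) S k)%g]/(fork_elt S s (inl t)).
apply: (KL_penultimate (@Dadj_sym n.+1) (@Dadj_irr n) hHH hbar hp (@fork_adj_par n s) _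
         (@fork_dep_par n s) (@fork_tree n s) (fork_elt_root S s) (@fork_elt_par n W S s)).
  by rewrite /= eqxx.
rewrite len_longestD /=; case: (t == s); lia.
Qed.

Lemma KL_value t b : (v + vV) * pen_coef S (inl b) w0 (inl t) =
  v ^+ (n.+1 * n.+2) * (v ^+ 2 * geo n.+1 + v ^+ (2 * n + 4) * (t == b)%:R
                        + (t == (if odd n.+1 then ~~ b else b))%:R).
Proof.
have cartan b' i : (v + vV) * pen_coef S b' w0 i - \sum_(j | Dadj b' j) pen_coef S j w0 i =
    v ^+ (n.+1 * n.+2 + (2 * n + 4)) * (i == b')%:R + v ^+ (n.+1 * n.+2) * (i == hat b')%:R.
  rewrite pen_coef_cartan; [|exact: Dadj_sym|exact: Dadj_irr].
  rewrite refl_act_longest_unit len_longestD mulNr opprK /unit_vec.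
  by congr (v ^+ _ * _ + _); lia.
have hat_eq b' : (t == (if odd n.+1 then ~~ b' else b')) = ((if odd n.+1 then ~~ t else t) == b').
  by case: (odd _); case: t; case: b'.
rewrite hat_eq; apply: (@solve_inl n (fun j => pen_coef S j w0 (inl t))).
  move=> b'; rewrite -hat_eq -(sum_adj_inl b' (fun j => pen_coef S j w0 (inl t))) cartan.
  by congr (_ * _%:R + _ * _%:R).
move=> m le_mn; rewrite -(sum_adj_nd (fun j => pen_coef S j w0 (inl t)) le_mn) cartan.
by rewrite /= !mulr0 addr0.
Qed.

Local Notation p_ i j := (p 1%g (w_ (ltnW hn) S i j)).

Lemma KL_vsum t c a e r :
  let s := if odd n.+1 then ~~ c else c in
  len S w0 = (a + 4 * e + r).+1 ->
  v ^+ (n.+1 * n.+2) * (v ^+ 2 * geo n.+1 + v ^+ n.+2.*2 * (t == s)%:R + (t == c)%:R) =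
    v ^+ r * geo (2 * e + 2) ->
  p_ (inl t) (inl c) = vsum (len S w0) a (a + 4 * e).
Proof.
move=> s len_w0 eq_geo; rewrite /w_ [hat _]/= -/s KL_fork; apply: (laurent_mulI q_neq0).
rewrite len_w0 q_vsum -eq_geo KL_value (_ : n.+2.*2 = 2 * n + 4)%N; last by lia.
by congr (_ * (_ + (_ == _)%:R)); rewrite /s; case: (odd _); rewrite ?negbK.
Qed.

Lemma KL_even_eq c : ~~ odd n.+1 ->
  p_ (inl c) (inl c) = vsum (len S w0) 1 (2 * n.+1 + 1).
Proof.
move=> even_n; have -> : (2 * n.+1 + 1 = 1 + 4 * n.+1./2)%N by lia.
apply: (@KL_vsum _ _ _ _ (n.+1 * n.+2)); first by rewrite len_longestD; lia.
rewrite (negPf even_n) eqxx mulr1 (_ : 2 * n.+1./2 + 2 = n.+3)%N; last by lia.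
rewrite [geo n.+3]geoS [geo n.+2]geo_shift -[true%:R]/1; congr (_ * _).
by move: (v ^+ _.*2) (v ^+ 2 * _) => a b; ring.
Qed.

Lemma KL_even_neq c : ~~ odd n.+1 ->
  p_ (inl c) (inl (~~ c)) = vsum (len S w0) 3 (2 * n.+1 - 1).
Proof.
move=> even_n; have -> : (2 * n.+1 - 1 = 3 + 4 * n./2)%N by lia.
apply: (@KL_vsum _ _ _ _ (n.+1 * n.+2 + 2)); first by rewrite len_longestD; lia.
rewrite (negPf even_n) (_ : (c == ~~ c) = false) ?addr0 ?mulr0; last by case: c.
by rewrite addr0 (_ : 2 * n./2 + 2 = n.+1)%N ?exprD ?mulrA //; lia.
Qed.

Lemma KL_odd_eq c : odd n.+1 ->
  p_ (inl c) (inl c) = vsum (len S w0) 3 (2 * n.+1 + 1).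
Proof.
move=> odd_n; have -> : (2 * n.+1 + 1 = 3 + 4 * n./2)%N by lia.
apply: (@KL_vsum _ _ _ _ (n.+1 * n.+2)); first by rewrite len_longestD; lia.
rewrite odd_n (_ : (c == ~~ c) = false) ?eqxx ?mulr0 ?addr0; last by case: c.
by rewrite (_ : 2 * n./2 + 2 = n.+2)%N; [rewrite [geo n.+2]geo_shift addrC | lia].
Qed.

Lemma KL_odd_neq c : odd n.+1 ->
  p_ (inl c) (inl (~~ c)) = vsum (len S w0) 1 (2 * n.+1 - 1).
Proof.
move=> odd_n; have -> : (2 * n.+1 - 1 = 1 + 4 * n./2)%N by lia.
apply: (@KL_vsum _ _ _ _ (n.+1 * n.+2 + 2)); first by rewrite len_longestD; lia.
rewrite odd_n negbK eqxx (_ : (c == ~~ c) = false) ?mulr1 ?addr0; last by case: c.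
rewrite (_ : 2 * n./2 + 2 = n.+2)%N; last by lia.
have -> : v ^+ n.+2.*2 = v ^+ 2 * v ^+ n.+1.*2 by rewrite -exprD.
rewrite [geo n.+2]geoS [v ^+ (_ + 2)]exprD.
by move: (v ^+ _) (v ^+ _.*2) (v ^+ 2) (geo _) => a b c' d; ring.
Qed.
End Main.

Theorem proposition5p30 (n : nat) (hn : (2 <= n)%N)
    (W : finGroupType) (S : coxeterSystem (@Dmatrix n) W)
    (HH : algType laurent) (H : Dnode n -> HH)
    (hHH : is_hecke_algebra (@Dmatrix n) H)
    (bar : {rmorphism HH -> HH}) (hbar : is_bar_involution H bar)
    (p : W -> W -> laurent) (hp : is_KL_family S H bar p) :
  let l0 := len S (longest S) in
  let p_ i j := p 1%g (w_ (ltnW hn) S i j) in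
  (~~ odd n ->
     [/\ p_ Oplus Oplus = vsum l0 1 (2 * n + 1),
         p_ Ominus Ominus = vsum l0 1 (2 * n + 1),
         p_ Oplus Ominus = vsum l0 3 (2 * n - 1) &
         p_ Ominus Oplus = vsum l0 3 (2 * n - 1)]) /\
  (odd n ->
     [/\ p_ Oplus Oplus = vsum l0 3 (2 * n + 1),
         p_ Ominus Ominus = vsum l0 3 (2 * n + 1),
         p_ Oplus Ominus = vsum l0 1 (2 * n - 1) &
         p_ Ominus Oplus = vsum l0 1 (2 * n - 1)]).
Proof.
case: n hn S H hHH bar hbar hp => [//|n] hn S H hHH bar hbar hp l0 p_.
split=> parity.
  have eqK := KL_even_eq hn hHH hbar hp _ parity.
  have neK := KL_even_neq hn hHH hbar hp _ parity.
  by split; [apply: (eqK true) | apply: (eqK false) | apply: (neK true) | apply: (neK false)].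
have eqK := KL_odd_eq hn hHH hbar hp _ parity.
have neK := KL_odd_neq hn hHH hbar hp _ parity.
by split; [apply: (eqK true) | apply: (eqK false) | apply: (neK true) | apply: (neK false)].
Qed.
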